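(* Let $X$ be a complex Banach space and $U\subset X^*$ an absolutely convex norm-open set. Then each $f\in H_{w^*u}(U)$ can be extended to some $\tilde f\in H_{w^*u}(\tilde U)$ if and only if $U$ is boundedly regular.
   Context: $\overline{\,\cdot\,}^{w^*}$ is the weak* closure in $X^*$ (topology $w(X^*,X)$) and $B_{X^*}$ is the open unit ball of $X^*$. For a norm-open set $U\subset X^*$, a subset $B\subset U$ is $U$-bounded if it is bounded and has positive distance to $X^*\setminus U$ (void condition if $U=X^*$). A fundamental family of $U$-bounded sets is a sequence $(B_n)_{n\ge1}$ such that each $B_n$ is $U$-bounded, each $U$-bounded set is contained in some $B_n$, and there are $r_n>0$ with $B_n+r_nB_{X^*}\subset B_{n+1}$ for all $n$. The envelope of $U$ is the norm-open set $\tilde U:=\bigcup\{\overline{B}^{w^*}: B \text{ is } U\text{-bounded}\}\supset U$. $U$ is boundedly regular if, for a fundamental family $(U_n)$ of $U$-bounded sets, $(\overline{U_n}^{w^*})_n$ is a fundamental family of $\tilde U$-bounded sets (this does not depend on the choice of the family). $H_{w^*u}(U)$ is the space of holomorphic functions $f:U\to\mathbb{C}$ that are uniformly $w(X^*,X)$-continuous on each $U$-bounded set $B$, i.e. for every $\varepsilon>0$ there is a weak* neighbourhood $V$ of $0$ in $X^*$ with $|f(x^* )-f(y^* )|<\varepsilon$ whenever $x^*,y^*\in B$ and $x^*-y^*\in V$. *)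

(* Defs.v *)
From HB Require Import structures.
From mathcomp Require Import all_boot all_order all_algebra.
From mathcomp Require Import all_classical all_reals all_analysis.
From mathcomp Require Export complex.

Set Implicit Arguments.
Unset Strict Implicit.
Unset Printing Implicit Defensive.

Import Order.TTheory GRing.Theory Num.Theory.
Import numFieldNormedType.Exports.

Local Open Scope classical_set_scope.
Local Open Scope ring_scope.
Local Open Scope complex_scope.

(* Norms of normed spaces over [R[i]] take nonnegative real values seen in
   [R[i]]. The order of [R[i]] is partial: [0 < r] in [R[i]] means that [r] is
   real and positive. [R[i]^o] is [R[i]] as a normed space over itself. *)

Section dual_space.
Variables (R : realType) (X : normedModType R[i]).

Definition dual_pred : {pred X -> R[i]^o} :=
  [pred f : X -> R[i]^o | `[< linear f /\ continuous f >]].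

Record dual := Dual {
  dual_fun :> X -> R[i]^o ;
  dual_funP : dual_fun \in dual_pred
}.

HB.instance Definition _ := [isSub for dual_fun].
HB.instance Definition _ := [Choice of dual by <:].

Fact dual_submod_closed : submod_closed dual_pred.
Proof.
split.
- apply/asboolP; split; last exact: cst_continuous.
  by move=> a x y; rewrite scaler0 addr0.
- move=> a f g /asboolP[lf cf] /asboolP[lg cg].
  apply/asboolP; split.
    move=> b x y; rewrite !fctE lf lg /=.
    rewrite !scalerDr addrACA; congr (_ + _ + _).
    by rewrite !scalerA mulrC.
  move=> x; apply: (@continuousD _ _ _ (a *: f) g); last exact: cg.
  by apply: continuousZl_tmp; exact: cf.
Qed.

HB.instance Definition _ :=
  GRing.isSubmodClosed.Build R[i] (X -> R[i]^o) dual_pred dual_submod_closed.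
HB.instance Definition _ := [SubChoice_isSubLmodule of dual by <:].

Lemma dual_linear (f : dual) : linear f.
Proof. by have /asboolP[] := dual_funP f. Qed.

Lemma dual_continuous (f : dual) : continuous f.
Proof. by have /asboolP[] := dual_funP f. Qed.

HB.instance Definition _ (f : dual) :=
  GRing.isLinear.Build R[i] X R[i]^o _ (f : X -> R[i]^o) (@dual_linear f).

Lemma dualD (f g : dual) x : (f + g) x = f x + g x.
Proof. by []. Qed.

Lemma dualZ (a : R[i]) (f : dual) x : (a *: f) x = a *: f x.
Proof. by []. Qed.

Lemma dual_eqP (f g : dual) : f =1 g -> f = g.
Proof. by move=> fg; apply/val_inj/funext. Qed.

Definition unit_ball_values (f : dual) : set R :=
  [set complex.Re `|f x| | x in [set x : X | `|x| <= 1]].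

Definition dual_norm (f : dual) : R[i] := (sup (unit_ball_values f))%:C.

Lemma normcRe (V : normedModType R[i]) (v : V) : `|v| = (complex.Re `|v|)%:C.
Proof. by rewrite RRe_real// normr_real. Qed.

Lemma has_sup_unit_ball_values (f : dual) : has_sup (unit_ball_values f).
Proof.
split; first by exists (complex.Re `|f 0|), 0 => //=; rewrite normr0.
have /linear_boundedP : bounded_near f (nbhs 0).
  by apply: continuous_linear_bounded; exact: dual_continuous.
move=> /pinfty_ex_gt0 [r r0 fr]; exists (complex.Re r) => _ [x /= x1 <-].
have : `|f x| <= r.
  by rewrite (le_trans (fr x))// ler_piMr// ltW.
by rewrite lecE => /andP[].
Qed.

Lemma le_dual_norm (f : dual) x : `|f x| <= dual_norm f * `|x|.
Proof.
have [->|x0] := eqVneq x 0; first by rewrite linear0 !normr0 mulr0.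
have nx0 : 0 < `|x| by rewrite normr_gt0.
rewrite -ler_pdivrMr// /dual_norm.
have -> : `|f x| / `|x| = `|f (`|x|^-1 *: x)|.
  by rewrite linearZ/= normrM ger0_norm ?invr_ge0// mulrC.
rewrite [leLHS]normcRe lecR; apply: ub_le_sup.
  by case: (has_sup_unit_ball_values f).
exists (`|x|^-1 *: x) => //=.
by rewrite normrZ ger0_norm ?invr_ge0// mulVf// gt_eqF.
Qed.

Lemma dual_norm_le (f : dual) (M : R[i]) :
  (forall x, `|x| <= 1 -> `|f x| <= M) -> dual_norm f <= M.
Proof.
move=> fM; have M0 : 0 <= M by rewrite (le_trans _ (fM 0 _))// normr0.
have MR : M = (complex.Re M)%:C by rewrite RRe_real// ger0_real.
rewrite MR lecR; apply: ge_sup; first by case: (has_sup_unit_ball_values f).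
by move=> _ [x /= x1 <-]; have := fM x x1; rewrite [leLHS]normcRe MR lecR.
Qed.

Lemma dual_norm_ge0 (f : dual) : 0 <= dual_norm f.
Proof.
rewrite lecR; apply: ub_le_sup; first by case: (has_sup_unit_ball_values f).
by exists 0; [rewrite /= normr0 | rewrite linear0 normr0].
Qed.

Fact dual_ler_normD (f g : dual) :
  dual_norm (f + g) <= dual_norm f + dual_norm g.
Proof.
apply: dual_norm_le => x x1; rewrite dualD (le_trans (ler_normD _ _))//.
by apply: lerD; rewrite (le_trans (le_dual_norm _ _))// ler_piMr// dual_norm_ge0.
Qed.

Let dual_norm_leZ (a : R[i]) (f : dual) :
  dual_norm (a *: f) <= `|a| * dual_norm f.
Proof.
apply: dual_norm_le => x x1; rewrite dualZ normrZ ler_wpM2l//.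
by rewrite (le_trans (le_dual_norm _ _))// ler_piMr// dual_norm_ge0.
Qed.

Fact dual_normrZ (a : R[i]) (f : dual) :
  dual_norm (a *: f) = `|a| * dual_norm f.
Proof.
apply/eqP; rewrite eq_le dual_norm_leZ/=.
have [->|a0] := eqVneq a 0; first by rewrite normr0 mul0r dual_norm_ge0.
rewrite -ler_pdivlMl ?normr_gt0// -normfV.
by rewrite (le_trans _ (dual_norm_leZ _ _))// scalerK.
Qed.

Fact dual_normr0_eq0 (f : dual) : dual_norm f = 0 -> f = 0.
Proof.
move=> f0; apply: dual_eqP => x; apply/eqP; rewrite -normr_le0.
by rewrite (le_trans (le_dual_norm f x))// f0 mul0r.
Qed.

HB.instance Definition _ := Lmodule_isNormed.Build R[i] dual
  dual_ler_normD dual_normrZ dual_normr0_eq0.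

(* The topology of [dual] is that of the norm; [weak_star] is the same set with
   the topology of pointwise convergence on [X]. *)
Definition weak_star : Type :=
  initial_topology (dual_fun : dual -> {ptws X -> R[i]^o}).

HB.instance Definition _ := Uniform.on weak_star.

End dual_space.

Section envelope.
Variables (R : realType) (X : normedModType R[i]).
Implicit Types (U B : set (dual X)) (f : dual X -> R[i]^o).

Definition weak_star_closure B : set (dual X) :=
  @closure (weak_star X) B.

Definition absolutely_convex U := forall (a b : R[i]) (x y : dual X),
  `|a| + `|b| <= 1 -> U x -> U y -> U (a *: x + b *: y).

Definition positive_distance (A B : set (dual X)) :=
  exists2 r : R[i], 0 < r & forall x y, A x -> B y -> r <= `|x - y|.

Definition U_bounded U B :=
  [/\ B `<=` U, bounded_set B & positive_distance B (~` U)].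

Definition fundamental_family U (B : (set (dual X))^nat) :=
  [/\ forall n, U_bounded U (B n),
      forall A, U_bounded U A -> exists n, A `<=` B n
    & forall n, exists2 r : R[i], 0 < r &
        [set x + r *: y | x in B n & y in ball (0 : dual X) 1] `<=` B n.+1].

Definition envelope U : set (dual X) :=
  \bigcup_(B in U_bounded U) weak_star_closure B.

Definition boundedly_regular U := exists2 B : (set (dual X))^nat,
  fundamental_family U B &
  fundamental_family (envelope U) (fun n => weak_star_closure (B n)).

Definition weak_star_unif_continuous_on B f :=
  forall e : R[i], 0 < e ->
    exists2 V : set (weak_star X), @nbhs _ (weak_star X) (0 : dual X) V &
      forall x y, B x -> B y -> V (x - y) -> `|f x - f y| < e.

(* A function on the open set [U] is represented by a total function, of which
   only the values on [U] matter. *)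
Definition holomorphic_on U f := forall x, U x -> differentiable f x.

Definition Hwsu U : set (dual X -> R[i]^o) :=
  [set f | holomorphic_on U f /\
           forall B, U_bounded U B -> weak_star_unif_continuous_on B f].

End envelope.

(* Main.v *)
(* If [U] is boundedly regular, [f] extends by weak* limits to the closures of a
   fundamental family. The extension is near each point a uniform limit of
   translates of [f] on a norm ball, hence it is holomorphic: Cauchy's estimate
   makes the differentials of the translates converge.

   Conversely, [U] has a fundamental family of absolutely convex sets [W n]. If
   some bounded set [A] of the envelope lay in no weak* closure of a [W n],
   Hahn-Banach would separate points [y_n] of [A] from the [W n] by points [z_n]
   of [X], and a lacunary series of powers of the evaluations at the [z_n] would
   be in [Hwsu U] with no extension bounded on [A]; but weak* uniform continuity
   on a bounded set forces boundedness.

   Holomorphy means complex differentiability at each point only, so Cauchy's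
   estimate needs Goursat's theorem. It is proved without integrals: midpoint
   sums over the boundaries of squares are additive under quartering, vanish on
   affine functions, and hence tend to zero by bisection. *)

Require Import Defs.
From HB Require Import structures.
From mathcomp Require Import all_boot all_order all_algebra.
From mathcomp Require Import all_classical all_reals all_analysis.
From mathcomp Require Import complex ring lra.

Set Implicit Arguments.
Unset Strict Implicit.
Unset Printing Implicit Defensive.

Import Order.TTheory GRing.Theory Num.Theory.
Import numFieldNormedType.Exports.

Local Open Scope classical_set_scope.
Local Open Scope ring_scope.
Local Open Scope complex_scope.

(** * Moduli and dyadic bisection *)

(** Two of the three clauses that make the weak* closures of a fundamental family of [U] a
    fundamental family of the envelope hold for every [U]: translations are weak* continuous and
    closed norm balls are weak* closed, so spacing and boundedness pass to the closures. The theorem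
    is therefore about the remaining clause, namely whether these closures absorb every bounded set
    of the envelope.

    In the converse, an extension is tied to its series only on [U], and the points [y_n] may lie
    outside. Each of them is in the weak* closure of some [W m], so weak* uniform continuity on that
    closure moves the estimate to a nearby point of [W m]. For this reason each separating point
    must be bounded by 1 not only on its own [W n] but on the [W m] attached to all earlier [y_i].

    The contour sums are never shown to converge. Bounds valid for all large [n] suffice, and in
    Cauchy's estimate the lower bound 4 stands in for the modulus of the integral of [1 / z]. *)

Section real_norm.
Variable R : realType.
Implicit Types (V : normedZmodType R[i]) (z : R[i]).

(** Norms are elements of [R[i]], whose order is partial; their real parts live in [R], where the
    order is total and [lra] applies. *)
Definition nrm V (v : V) : R := complex.Re `|v|.

Lemma nrmE V (v : V) : `|v| = (nrm v)%:C.
Proof. by rewrite RRe_real// normr_real. Qed.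

Lemma nrm_ge0 V (v : V) : 0 <= nrm v.
Proof. by rewrite -ler0c -nrmE normr_ge0. Qed.

Lemma nrm0 V : nrm (0 : V) = 0.
Proof. by rewrite /nrm normr0. Qed.

Lemma nrm0_eq0 V (v : V) : nrm v = 0 -> v = 0.
Proof. by move=> v0; apply: normr0_eq0; rewrite nrmE v0. Qed.

Lemma nrmN V (v : V) : nrm (- v) = nrm v.
Proof. by rewrite /nrm normrN. Qed.

Lemma nrmB V (v w : V) : nrm (v - w) = nrm (w - v).
Proof. by rewrite -nrmN opprB. Qed.

Lemma nrmD V (v w : V) : nrm (v + w) <= nrm v + nrm w.
Proof. by rewrite -lecR rmorphD/= -!nrmE ler_normD. Qed.

Lemma nrmD_le V (v w : V) a b : nrm v <= a -> nrm w <= b -> nrm (v + w) <= a + b.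
Proof. by move=> va wb; rewrite (le_trans (nrmD _ _))// lerD. Qed.

Lemma nrmB_le V (u v w : V) a b :
  nrm (u - v) <= a -> nrm (v - w) <= b -> nrm (u - w) <= a + b.
Proof. by move=> va wb; rewrite -(subrK v u) -addrA nrmD_le. Qed.

Lemma nrmM z1 z2 : nrm (z1 * z2) = nrm z1 * nrm z2.
Proof. by apply: complexI; rewrite rmorphM/= -!nrmE normrM. Qed.

Lemma nrmX z n : nrm (z ^+ n) = nrm z ^+ n.
Proof. by apply: complexI; rewrite rmorphXn/= -!nrmE normrX. Qed.

Lemma nrmV z : nrm z^-1 = (nrm z)^-1.
Proof. by apply: complexI; rewrite fmorphV/= -!nrmE normfV. Qed.

Lemma nrmZ (V : normedModType R[i]) z (v : V) : nrm (z *: v) = nrm z * nrm v.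
Proof. by apply: complexI; rewrite rmorphM/= -!nrmE normrZ. Qed.

Lemma nrm_real (x : R) : nrm x%:C = `|x|.
Proof. by rewrite /nrm normc_def/= expr0n addr0 sqrtr_sqr. Qed.

Lemma nrm1 : nrm (1 : R[i]) = 1.
Proof. by rewrite /nrm normr1. Qed.

Lemma nrmi : nrm ('i : R[i]) = 1.
Proof. by rewrite /nrm normc_def/= expr0n/= expr1n add0r sqrtr1. Qed.

Lemma le_Re_nrm z : `|complex.Re z| <= nrm z.
Proof. by rewrite -lecR -nrmE normc_ge_Re. Qed.

Lemma le_Im_nrm z : `|complex.Im z| <= nrm z.
Proof. by rewrite -[nrm z]mul1r -nrmi -nrmM mulrC (le_trans _ (le_Re_nrm _))// ReiNIm normrN. Qed.

Lemma nrm_leReIm z : nrm z <= `|complex.Re z| + `|complex.Im z|.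
Proof.
rewrite {1}[z]complexE; apply: nrmD_le; first by rewrite nrm_real.
by rewrite nrmM nrmi mul1r nrm_real.
Qed.

Lemma nrm_sum (V : normedZmodType R[i]) n (F : nat -> V) :
  nrm (\sum_(j < n) F j) <= \sum_(j < n) nrm (F j).
Proof.
elim: n => [|n IH]; first by rewrite !big_ord0 nrm0.
by rewrite !big_ord_recr/= nrmD_le.
Qed.

Lemma real_cauchy (u : nat -> R) :
  (forall e : R, 0 < e -> exists N, forall n, (N <= n)%N -> `|u n - u N| <= e) ->
  exists l, forall e : R, 0 < e -> exists N, forall n, (N <= n)%N ->
     `|u n - l| <= e.
Proof.
move=> cu.
have /cvg_ex[l ul] : cvgn u.
  apply/cauchy_cvgP/cauchy_exP => e e0.
  have [N uN] := cu (e / 2) (divr_gt0 e0 (ltr0Sn _ 1)).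
  exists (u N); exists N => // n /= /uN.
  rewrite -ball_normE/= distrC => /le_lt_trans; apply.
  by rewrite ltr_pdivrMr// mulr_natr mulr2n ltrDl.
exists l => e e0; have /cvgrPdist_le/(_ e e0)[N _ uN] := ul.
by exists N => n Nn; rewrite distrC; apply: uN.
Qed.

Lemma complex_cauchy (u : nat -> R[i]) :
  (forall e : R, 0 < e -> exists N, forall n, (N <= n)%N -> nrm (u n - u N) <= e) ->
  exists l, forall e : R, 0 < e -> exists N, forall n, (N <= n)%N ->
     nrm (u n - l) <= e.
Proof.
move=> cu.
have [|x xP] := @real_cauchy (fun n => complex.Re (u n)).
  move=> e /cu[N uN]; exists N => n /uN; apply: le_trans.
  by rewrite -raddfB le_Re_nrm.
have [|y yP] := @real_cauchy (fun n => complex.Im (u n)).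
  move=> e /cu[N uN]; exists N => n /uN; apply: le_trans.
  by rewrite -raddfB le_Im_nrm.
exists (x +i* y) => e e0; have e2 : 0 < e / 2 by rewrite divr_gt0.
have [N1 H1] := xP _ e2; have [N2 H2] := yP _ e2.
exists (maxn N1 N2) => n; rewrite geq_max => /andP[/H1 h1 /H2 h2].
rewrite [e]splitr (le_trans (nrm_leReIm _))// lerD//.
  by case: (u n) h1.
by case: (u n) h2.
Qed.

(* A property of dyadic squares inherited by one of the four quarters descends
   to a point; [(x, y, k)] encodes the square [[x, x + 2^-k] * [y, y + 2^-k]]. *)
Lemma dyadic_bisection (P : nat -> R -> R -> Prop) :
  P 0%N 0 0 ->
  (forall k x y, P k x y -> exists b c : bool,
     P k.+1 (x + b%:R * 2 ^- k.+1) (y + c%:R * 2 ^- k.+1)) ->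
  exists x y, forall k, exists x' y', [/\ P k x' y',
     0 <= x' <= x /\ x <= x' + 2 ^- k <= 1 & 0 <= y' <= y /\ y <= y' + 2 ^- k <= 1].
Proof.
move=> P0 PS.
(* [F] is made total by choosing the lower left quarter where [P] fails, so the squares can be
   iterated without carrying proofs. *)
have /choice[F FP] : forall s : nat * R * R, exists bc : bool * bool,
    P s.1.1 s.1.2 s.2 ->
    P s.1.1.+1 (s.1.2 + bc.1%:R * 2 ^- s.1.1.+1) (s.2 + bc.2%:R * 2 ^- s.1.1.+1).
  move=> [[k x] y]; have [Pk|] := pselect (P k x y); last by exists (false, false).
  by have [b [c bc]] := PS _ _ _ Pk; exists (b, c).
pose step (s : nat * R * R) : nat * R * R := (s.1.1.+1,
  s.1.2 + (F s).1%:R * 2 ^- s.1.1.+1, s.2 + (F s).2%:R * 2 ^- s.1.1.+1).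
pose s k := iter k step (0%N, 0, 0).
have sk k : (s k).1.1 = k by elim: k => //= k ->.
have sP k : P k (s k).1.2 (s k).2.
  elim: k => //= k IH; have := FP (s k); rewrite sk; exact.
(* Each coordinate is treated alone: left ends increase, right ends decrease, and every left end
   lies below every right end, so the supremum of the left ends is in all the intervals. *)
have nest (v : nat -> R) (b : nat -> bool) :
    v 0%N = 0 -> (forall k, v k.+1 = v k + (b k)%:R * 2 ^- k.+1) ->
    exists x, forall k, 0 <= v k <= x /\ x <= v k + 2 ^- k <= 1.
  move=> v0 vS.
  have half k : 2 ^- k = 2 ^- k.+1 + 2 ^- k.+1 :> R.
    by rewrite [LHS]splitr exprSr invfM.
  have p0 k : 0 < 2 ^- k :> R by rewrite invr_gt0 exprn_gt0.
  have vle k : v k <= v k.+1 by rewrite vS lerDl mulr_ge0// ltW.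
  have vge k : v k.+1 + 2 ^- k.+1 <= v k + 2 ^- k.
    rewrite vS (half k) addrA lerD2r lerD2l.
    by case: (b k); rewrite ?mul1r// mul0r ltW.
  have mono k l : (k <= l)%N -> v k <= v l.
    by move=> kl; rewrite -(subnK kl); elim: (l - k)%N => //= d /le_trans; apply; rewrite addSn.
  have mono' k l : (k <= l)%N -> v l + 2 ^- l <= v k + 2 ^- k.
    move=> kl; rewrite -(subnK kl); elim: (l - k)%N => //= d.
    by apply: le_trans; rewrite addSn vge.
  have cross k l : v l <= v k + 2 ^- k.
    have [kl|/ltnW lk] := leqP k l.
      by rewrite (le_trans _ (mono' _ _ kl))// lerDl ltW.
    by rewrite (le_trans (mono _ _ lk))// lerDl ltW.
  exists (sup (range v)) => k.
  have hs : has_sup (range v).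
    by split; [exists (v 0%N), 0%N|exists (v k + 2 ^- k) => _ [l _ <-]].
  split; apply/andP; split.
  - by rewrite -v0 mono.
  - by apply: ub_le_sup; [case: hs|exists k].
  - by apply: ge_sup; [case: hs|move=> _ [l _ <-]].
  - by rewrite (le_trans (mono' 0%N k _))// v0 expr0 invr1 add0r.
have [x xP] := nest (fun k => (s k).1.2) (fun k => (F (s k)).1) erefl
  (fun k => ltac:(by rewrite /= sk)).
have [y yP] := nest (fun k => (s k).2) (fun k => (F (s k)).2) erefl
  (fun k => ltac:(by rewrite /= sk)).
by exists x, y => k; exists (s k).1.2, (s k).2; split.
Qed.

End real_norm.

(** * Goursat's theorem for discrete contour sums *)

Section discrete_contour_sums.
Variable R : realType.
Local Notation C := R[i].
Implicit Types (f g : C -> C) (a d z l : C).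

Definition cderiv f z l := forall e : R, 0 < e -> exists2 r : R, 0 < r &
  forall w, nrm (w - z) < r -> nrm (f w - f z - l * (w - z)) <= e * nrm (w - z).

(* Midpoint Riemann sum of [f] on the segment from [a] to [a + d] cut into
   [2 ^ n] equal pieces. *)
Fixpoint edge_sum f n a d : C :=
  if n is m.+1 then edge_sum f m a (d / 2) + edge_sum f m (a + d / 2) (d / 2)
  else d * f (a + d / 2).

(** The boundary is run counterclockwise, but the upper and left edges are traversed forwards and
    subtracted; an edge shared by two subsquares is then the same term with opposite signs. *)
Definition square_sum f n a d := edge_sum f n a d + edge_sum f n (a + d) ('i * d)
  - edge_sum f n (a + 'i * d) d - edge_sum f n a ('i * d).

Lemma edge_sumB f g n a d :
  edge_sum (fun z => f z - g z) n a d = edge_sum f n a d - edge_sum g n a d.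
Proof.
elim: n a d => [|n IH] a d /=; first by rewrite mulrBr.
by rewrite !IH opprD addrACA.
Qed.

Lemma edge_sumM (k : C) f n a d :
  edge_sum (fun z => k * f z) n a d = k * edge_sum f n a d.
Proof.
elim: n a d => [|n IH] a d /=; first by rewrite mulrCA.
by rewrite !IH mulrDr.
Qed.

Lemma eq_edge_sum f g n a d : f =1 g -> edge_sum f n a d = edge_sum g n a d.
Proof. by move=> /funext->. Qed.

Lemma edge_sum_rot f n (k : C) a d :
  edge_sum f n (k * a) (k * d) = k * edge_sum (fun z => f (k * z)) n a d.
Proof.
elim: n a d => [|n IH] a d /=; first by rewrite mulrDr !mulrA.
by rewrite mulrDr -!IH mulrDr !mulrA.
Qed.

Lemma edge_sum_rev f n a d : edge_sum f n (a + d) (- d) = - edge_sum f n a d.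
Proof.
elim: n a d => [|n IH] a d /=; first by rewrite mulNr; congr (- (_ * f _)); field.
by rewrite opprD [RHS]addrC -!IH; congr (edge_sum _ _ _ _ + edge_sum _ _ _ _); field.
Qed.

Lemma real_complex_half (t : R) : (t / 2)%:C = t%:C / 2 :> C.
Proof. by rewrite rmorphM fmorphV rmorph_nat. Qed.

Lemma half_segment (P : C -> Prop) a d :
  (forall t : R, 0 <= t <= 1 -> P (a + t%:C * d)) ->
  (forall t : R, 0 <= t <= 1 -> P (a + t%:C * (d / 2))) /\
  (forall t : R, 0 <= t <= 1 -> P (a + d / 2 + t%:C * (d / 2))).
Proof.
have d2 (s : R) : s%:C * (d / 2) = (s / 2)%:C * d.
  by rewrite real_complex_half; field.
move=> Pd; split=> t /andP[t0 t1].
  by rewrite d2; apply: Pd; lra.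
rewrite d2 -addrA -[d / 2]mul1r -(rmorph1 (real_complex R)) d2 -mulrDl -rmorphD/=.
by apply: Pd; lra.
Qed.

Lemma edge_sum_le f n a d K :
  (forall t : R, 0 <= t <= 1 -> nrm (f (a + t%:C * d)) <= K) ->
  nrm (edge_sum f n a d) <= nrm d * K.
Proof.
have half : nrm (1 / 2 : C) = 1 / 2.
  by rewrite -(rmorph1 (real_complex R)) -real_complex_half nrm_real ger0_norm; lra.
elim: n a d => [|n IH] a d fK /=.
  rewrite nrmM ler_wpM2l ?nrm_ge0//; have := fK (1 / 2).
  by rewrite real_complex_half rmorph1 !mul1r [2^-1 * d]mulrC; apply; lra.
have [h1 h2] := half_segment (P := fun z => nrm (f z) <= K) fK.
apply: le_trans (nrmD_le (IH _ _ h1) (IH _ _ h2)) _.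
by rewrite nrmM -[2^-1 in X in X <= _]mul1r half; lra.
Qed.

(** This serves the lower bound on the sums of [z^-1], whose imaginary part is bounded below on the
    lower edge of a centred square. *)
Lemma edge_sum_Im_ge f n a (d : R) K : 0 <= d ->
  (forall t : R, 0 <= t <= 1 -> K <= complex.Im (f (a + t%:C * d%:C))) ->
  d * K <= complex.Im (edge_sum f n a d%:C).
Proof.
elim: n a d => [|n IH] a d d0 fK /=.
  have /= := fK (1 / 2).
  rewrite real_complex_half rmorph1 !mul1r [2^-1 * _]mulrC => h.
  have {h} : K <= complex.Im (f (a + d%:C / 2)) by apply: h; lra.
  by case: (f _) => u v /= Kv; rewrite mul0r addr0 ler_wpM2l.
have [] := half_segment (P := fun z => K <= complex.Im (f z)) fK.
rewrite -real_complex_half.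
move=> /IH h1 /IH h2; rewrite raddfD/=.
have : 0 <= d / 2 by lra.
by move=> /[dup]/h1 {}h1 /h2 {}h2; lra.
Qed.

Lemma square_sumB f g n a d :
  square_sum (fun z => f z - g z) n a d = square_sum f n a d - square_sum g n a d.
Proof. by rewrite /square_sum !edge_sumB; ring. Qed.

Lemma square_sumM (k : C) f n a d :
  square_sum (fun z => k * f z) n a d = k * square_sum f n a d.
Proof. by rewrite /square_sum !edge_sumM; ring. Qed.

Lemma square_sumS f n a d : square_sum f n.+1 a d =
  square_sum f n a (d / 2) + square_sum f n (a + d / 2) (d / 2) +
  square_sum f n (a + 'i * (d / 2)) (d / 2) +
  square_sum f n (a + d / 2 + 'i * (d / 2)) (d / 2).
Proof.
rewrite /square_sum /=.
have -> : 'i * d / 2 = 'i * (d / 2) by rewrite mulrA.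
have -> : 'i * d = 'i * (d / 2) + 'i * (d / 2) :> C by field.
have -> : a + d = a + d / 2 + d / 2 :> C by field.
rewrite !addrA.
have -> : a + 'i * (d / 2) + 'i * (d / 2) + d / 2 =
          a + d / 2 + 'i * (d / 2) + 'i * (d / 2) by ring.
have -> : a + 'i * (d / 2) + d / 2 = a + d / 2 + 'i * (d / 2) by ring.
have -> : a + d / 2 + 'i * (d / 2) + d / 2 = a + d / 2 + d / 2 + 'i * (d / 2) by ring.
by ring.
Qed.

(** With one piece per edge, the horizontal edges contribute [- l * 'i * d ^+ 2] and the vertical
    ones [l * 'i * d ^+ 2]; quartering propagates the cancellation. *)
Lemma square_sum_affine (k l : C) n a d :
  square_sum (fun z => k + l * z) n a d = 0.
Proof.
elim: n a d => [|n IH] a d; last by rewrite square_sumS !IH !addr0.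
have i2 := sqr_i R; rewrite /square_sum /=.
transitivity (- (l * d ^+ 2) * ('i ^+ 2 + 1) + l * d ^+ 2 * ('i ^+ 2 + 1)); last first.
  by rewrite i2; ring.
by field.
Qed.

Lemma in_square_edges (P : C -> Prop) a d :
  (forall x y : R, 0 <= x <= 1 -> 0 <= y <= 1 -> P (a + (x +i* y) * d)) ->
  [/\ forall t : R, 0 <= t <= 1 -> P (a + t%:C * d),
      forall t : R, 0 <= t <= 1 -> P (a + d + t%:C * ('i * d)),
      forall t : R, 0 <= t <= 1 -> P (a + 'i * d + t%:C * d) &
      forall t : R, 0 <= t <= 1 -> P (a + t%:C * ('i * d))].
Proof.
have e0 : 0 <= (0 : R) <= 1 by rewrite lexx ler01.
have e1 : 0 <= (1 : R) <= 1 by rewrite lexx ler01.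
have xy (x y : R) : x +i* y = x%:C + 'i * y%:C by rewrite [LHS]complexE.
move=> Pd; split=> t t01.
- by have := Pd t 0 t01 e0.
- have := Pd 1 t e1 t01; rewrite xy rmorph1.
  by congr (P _); ring.
- have := Pd t 1 t01 e1; rewrite xy rmorph1.
  by congr (P _); ring.
- have := Pd 0 t e0 t01; rewrite xy rmorph0.
  by congr (P _); ring.
Qed.

Lemma square_sum_le f n a d K :
  (forall x y : R, 0 <= x <= 1 -> 0 <= y <= 1 -> nrm (f (a + (x +i* y) * d)) <= K) ->
  nrm (square_sum f n a d) <= 4 * (nrm d * K).
Proof.
move=> /(in_square_edges (P := fun z => nrm (f z) <= K))[].
move=> /(edge_sum_le n)h1 /(edge_sum_le n)h2 /(edge_sum_le n)h3 /(edge_sum_le n)h4.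
move: h2 h4; rewrite nrmM nrmi mul1r => h2 h4.
rewrite -nrmN in h3; rewrite -nrmN in h4.
by apply: le_trans (nrmD_le (nrmD_le (nrmD_le h1 h2) h3) h4) _; lra.
Qed.

Definition vanishing (u : nat -> C) := forall e : R, 0 < e ->
  exists N, forall n, (N <= n)%N -> nrm (u n) <= e.

Lemma vanishingD u v : vanishing u -> vanishing v -> vanishing (fun n => u n + v n).
Proof.
move=> hu hv e e0; have e2 : 0 < e / 2 by rewrite divr_gt0.
have [N Nu] := hu _ e2; have [M Mv] := hv _ e2.
exists (maxn N M) => n; rewrite geq_max => /andP[/Nu ? /Mv ?].
by rewrite [e]splitr nrmD_le.
Qed.

Lemma exp2V_lt (c e : R) : 0 < e -> exists k : nat, 2 ^- k * c < e.
Proof.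
move=> e0; pose k := (Num.truncn (c / e)).+1; exists k.
have p0 : 0 < 2 ^+ k :> R by rewrite exprn_gt0.
have ck : c / e < 2 ^+ k.
  by rewrite (lt_le_trans (truncnS_gt _))// -/k -natrX ler_nat; exact/ltnW/ltn_expl.
by rewrite mulrC ltr_pdivrMr// [e * _]mulrC -ltr_pdivrMr.
Qed.

(** The bisected property is a failure for arbitrarily large [n]. It passes to a quarter because
    bounds valid for large [n] on all four quarters add up, while near the limit point the error of
    the affine expansion is at most [eta] times the distance. *)
Lemma goursat f a d :
  (forall x y : R, 0 <= x <= 1 -> 0 <= y <= 1 ->
     exists l, cderiv f (a + (x +i* y) * d) l) ->
  vanishing (fun n => square_sum f n a d).
Proof.
move=> df e e0; apply: contrapT => nogood.
pose good k (x y : R) := exists N, forall n, (N <= n)%N ->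
  nrm (square_sum f n (a + (x +i* y) * d) ((2 ^- k)%:C * d)) <= e / 4 ^+ k.
have [||x [y xyP]] := @dyadic_bisection R (fun k x y => ~ good k x y).
- move=> [N gN]; apply: nogood; exists N => n /gN.
  by rewrite !expr0 !invr1 rmorph1 mul1r mulr1 (_ : 0 +i* 0 = 0)// mul0r addr0.
- move=> k x y bad; apply: contrapT => nobad; apply: bad.
  have all_good (b c : bool) : good k.+1 (x + b%:R * 2 ^- k.+1) (y + c%:R * 2 ^- k.+1).
    by apply: contrapT => h; apply: nobad; exists b, c.
  have [N1 G1] := all_good false false; have [N2 G2] := all_good true false.
  have [N3 G3] := all_good false true; have [N4 G4] := all_good true true.
  (* The successor is the level lost by quartering: level [n.+1] on a square is level [n] on its
     quarters. *)
  exists (maxn (maxn N1 N2) (maxn N3 N4)).+1 => -[//|n].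
  rewrite ltnS !geq_max => /andP[/andP[/G1 g1 /G2 g2] /andP[/G3 g3 /G4 g4]].
  have xy (u v : R) : u +i* v = u%:C + 'i * v%:C by rewrite [LHS]complexE.
  have d2 : (2 ^- k)%:C * d / 2 = (2 ^- k.+1)%:C * d :> C.
    by rewrite exprSr invfM real_complex_half mulrAC.
  rewrite square_sumS d2.
  have -> : e / 4 ^+ k = e / 4 ^+ k.+1 + e / 4 ^+ k.+1 + e / 4 ^+ k.+1 + e / 4 ^+ k.+1.
    by rewrite exprSr invfM; move: (4 ^- k) => t; field.
  move: g1 g2 g3 g4; rewrite !xy ?mul1r ?mul0r ?addr0 !rmorphD/=.
  move: (2 ^- k.+1)%:C => t g1 g2 g3 g4.
  apply: nrmD_le; [apply: nrmD_le; [apply: nrmD_le|]|].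
  + exact: g1.
  + by move: g2; congr (nrm (square_sum _ _ _ _) <= _); ring.
  + by move: g3; congr (nrm (square_sum _ _ _ _) <= _); ring.
  + by move: g4; congr (nrm (square_sum _ _ _ _) <= _); ring.
have [x01 y01] : 0 <= x <= 1 /\ 0 <= y <= 1.
  have [x' [y' [_ [/andP[? ?] /andP[? ?]] [/andP[? ?] /andP[? ?]]]]] := xyP 0%N.
  by split; apply/andP; split; lra.
have [l fl] := df _ _ x01 y01.
set z0 := a + (x +i* y) * d in fl.
(* The 8 comes from four edges and from points at distance at most [2 * nrm D] from [z0]; adding 1
   keeps the denominator positive when [d] is zero. *)
pose eta := e / (8 * nrm d ^+ 2 + 1).
have den : 0 < 8 * nrm d ^+ 2 + 1 by rewrite ltr_wpDl// mulr_ge0// sqr_ge0.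
have eta0 : 0 < eta by rewrite divr_gt0.
have [r r0 flr] := fl _ eta0.
have [k kr] := exp2V_lt (2 * nrm d) r0.
have [x' [y' [bad [/andP[_ xa] /andP[xb _]] [/andP[_ ya] /andP[yb _]]]]] := xyP k.
apply: bad; exists 0%N => n _.
have p0 : 0 <= 2 ^- k :> R by rewrite invr_ge0 exprn_ge0.
set A := a + (x' +i* y') * d; set D := (2 ^- k)%:C * d.
have nD : nrm D = 2 ^- k * nrm d by rewrite nrmM nrm_real ger0_norm.
have -> : square_sum f n A D =
    square_sum (fun z => f z - (f z0 - l * z0 + l * z)) n A D.
  by rewrite square_sumB square_sum_affine subr0.
apply: (@le_trans _ _ (4 * (nrm D * (eta * (2 * nrm D))))).
  apply: square_sum_le => s t /andP[s0 s1] /andP[t0 t1].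
  have -> : forall w, f w - (f z0 - l * z0 + l * w) = f w - f z0 - l * (w - z0).
    by move=> w; ring.
  have wz0 : nrm (A + (s +i* t) * D - z0) <= 2 * nrm D.
    have -> : A + (s +i* t) * D - z0 =
        ((x' - x + s * 2 ^- k) +i* (y' - y + t * 2 ^- k)) * d.
      rewrite /A /D /z0.
      have -> : ((x' - x + s * 2 ^- k) +i* (y' - y + t * 2 ^- k)) =
         (x' +i* y') - (x +i* y) + (s +i* t) * (2 ^- k)%:C :> C.
        by apply/eqP; rewrite eq_complex /= !mulr0 subr0 add0r !eqxx.
      by ring.
    rewrite nrmM nD mulrA ler_wpM2r ?nrm_ge0//.
    rewrite (le_trans (nrm_leReIm _))//= [2 * _]mulr_natl mulr2n lerD//.
      have : 0 <= s * 2 ^- k <= 2 ^- k by rewrite mulr_ge0//= ler_piMl.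
      by move=> /andP[? ?]; rewrite ler_norml; lra.
    have : 0 <= t * 2 ^- k <= 2 ^- k by rewrite mulr_ge0//= ler_piMl.
    by move=> /andP[? ?]; rewrite ler_norml; lra.
  apply: le_trans (flr _ _) _.
    by rewrite (le_lt_trans wz0)// nD; move: kr; congr (_ < _); ring.
  by rewrite ler_wpM2l// ltW.
have -> : 4 * (nrm D * (eta * (2 * nrm D))) = (8 * nrm d ^+ 2 * eta) / 4 ^+ k.
  have -> : 4 ^+ k = 2 ^+ k * 2 ^+ k :> R by rewrite -exprMn; congr (_ ^+ _); ring.
  by rewrite nD invfM; ring.
by rewrite ler_wpM2r ?invr_ge0 ?exprn_ge0// /eta mulrA ler_pdivrMr// mulrC ler_wpM2l ?(ltW e0)// lerDl.
Qed.

End discrete_contour_sums.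

(** * Cauchy's estimate *)

Section differentiability.
Variable R : realType.
Local Notation C := R[i].

Lemma gt0_complexP (e : C) : 0 < e -> e = (complex.Re e)%:C /\ 0 < complex.Re e.
Proof.
move=> e0; have eE : e = (complex.Re e)%:C by rewrite RRe_real// gtr0_real.
by split=> //; rewrite -ltcR -eE.
Qed.

Lemma nbhs_nrmP (E : normedModType C) (x : E) (P : set E) :
  nbhs x P <-> exists2 r : R, 0 < r & forall y, nrm (y - x) < r -> P y.
Proof.
split.
  move=> /nbhs_normP[e /= /gt0_complexP[-> e0] eP]; exists (complex.Re e) => // y yx.
  by apply: eP => /=; rewrite -opprB normrN nrmE ltcR.
move=> [r r0 rP]; apply/nbhs_normP; exists r%:C => /=; first by rewrite ltcR.
by move=> y /=; rewrite -opprB normrN nrmE ltcR => /rP.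
Qed.

Lemma differentiable_nrm (E F : normedModType C) (f : E -> F) x :
  differentiable f x -> forall e : R, 0 < e -> exists2 r : R, 0 < r &
    forall h, nrm h < r -> nrm (f (x + h) - f x - 'd f x h) <= e * nrm h.
Proof.
move=> /diff_locallyP[_ /eqaddoP fx] e e0.
have /fx/nbhs_nrmP[r r0 rP] : 0 < e%:C :> C by rewrite ltcR.
exists r => // h; rewrite -[h in nrm h < r]subr0 => /rP /=.
rewrite !fctE !nrmE -rmorphM lecR; congr (nrm _ <= _).
by rewrite opprD addrA /shift/= [x + h]addrC.
Qed.

Lemma nrm_differentiable (E F : normedModType C) (f : E -> F)
    (L : {linear E -> F}) x : continuous L ->
  (forall e : R, 0 < e -> exists2 r : R, 0 < r &
     forall h, nrm h < r -> nrm (f (x + h) - f x - L h) <= e * nrm h) ->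
  differentiable f x.
Proof.
move=> cL fL; have fxL : f \o shift x = cst (f x) + L +o_ 0 id.
  apply/eqaddoP => e /gt0_complexP[-> e0].
  have [r r0 rP] := fL _ e0.
  apply/nbhs_nrmP; exists r => // h; rewrite subr0 => /rP /=.
  rewrite !fctE !nrmE -rmorphM lecR; congr (nrm _ <= _).
  by rewrite opprD addrA /shift/= [x + h]addrC.
apply/diff_locallyP; have dL := diff_unique cL fxL.
by rewrite dL.
Qed.

Lemma cderivP (f : C -> C) z :
  (exists l, cderiv f z l) <-> differentiable (f : C^o -> C^o) (z : C^o).
Proof.
split.
  move=> [l fl]; have lin : linear (fun h : C^o => l * h : C^o).
    by move=> a x y; rewrite mulrDr -[a *: x]/(a * x) mulrCA.
  pose L : {linear C^o -> C^o} := HB.pack (fun h : C^o => l * h : C^o)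
    (GRing.isLinear.Build _ _ _ _ _ lin).
  apply: (@nrm_differentiable _ _ _ L); last first.
    move=> e /fl[r r0 rP]; exists r => // h hr.
    by have := rP (z + h); rewrite addrAC subrr add0r; apply.
  by move=> x; apply: (@mulrl_continuous C).
move=> /differentiable_nrm fz; exists ('d (f : C^o -> C^o) (z : C^o) 1) => e /fz[r r0 rP].
exists r => // w /rP; rewrite [z + _]addrC subrK; congr (nrm (_ - _) <= _).
by rewrite -{1}[w - z]mulr1 -[_ * 1]/((w - z) *: (1 : C^o)) linearZ/= mulrC.
Qed.

End differentiability.

Section cauchy_estimate.
Variable R : realType.
Local Notation C := R[i].
Implicit Types (f : C -> C) (c : R).

Let corner c : C := (- c) +i* (- c).
Let side c : C := (2 * c)%:C.

Ltac cring := apply/eqP; rewrite eq_complex /=; apply/andP; split; apply/eqP; ring.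

(* [corner c] is multiplied by the powers of ['i] along the four edges. *)
Lemma square_sum_centered f n c : square_sum f n (corner c) (side c) =
  edge_sum f n (corner c) (side c)
  + 'i * edge_sum (fun z => f ('i * z)) n (corner c) (side c)
  + (-1) * edge_sum (fun z => f (-1 * z)) n (corner c) (side c)
  + (- 'i) * edge_sum (fun z => f (- 'i * z)) n (corner c) (side c).
Proof.
rewrite -!edge_sum_rot /square_sum; congr (_ + _ + _ + _).
- by congr (edge_sum _ _ _ _); cring.
- by rewrite -edge_sum_rev; congr (edge_sum _ _ _ _); cring.
- by rewrite -edge_sum_rev; congr (edge_sum _ _ _ _); cring.
Qed.

(** There are four edges of length [2 * c], and their points have modulus at least the distance [c]
    of the edges to zero and at most [c + c]. *)
Lemma square_sum_centered_le f n c K : 0 < c ->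
  (forall z, c <= nrm z <= 2 * c -> nrm (f z) <= K) ->
  nrm (square_sum f n (corner c) (side c)) <= 8 * c * K.
Proof.
move=> c0 fK; rewrite square_sum_centered.
have nside : nrm (side c) = 2 * c by rewrite nrm_real ger0_norm// mulr_ge0// ltW.
have edge k : nrm k = 1 ->
    nrm (edge_sum (fun z => f (k * z)) n (corner c) (side c)) <= 2 * c * K.
  move=> k1; rewrite -nside; apply: edge_sum_le => t /andP[t0 t1].
  apply: fK; rewrite nrmM k1 mul1r.
  have -> : corner c + t%:C * side c = ((2 * t - 1) * c) +i* (- c) by cring.
  apply/andP; split.
    by rewrite (le_trans _ (le_Im_nrm _))//= normrN gtr0_norm.
  rewrite (le_trans (nrm_leReIm _))//= normrM normrN (gtr0_norm c0).
  rewrite [2 * c]mulr_natl mulr2n lerD2r ler_piMl ?(ltW c0)// ler_norml; lra.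
have i1 := nrmi R; have n1 := nrm1 R.
have [ni1 nn1] : nrm (- 'i : C) = 1 /\ nrm (-1 : C) = 1 by rewrite !nrmN.
have := edge 1 n1; have := edge _ i1; have := edge _ nn1; have := edge _ ni1.
rewrite (@eq_edge_sum _ (fun z => f (1 * z)) f); last by move=> z; rewrite mul1r.
move=> e4 e3 e2 e1.
have -> : 8 * c * K = 2 * c * K + 2 * c * K + 2 * c * K + 2 * c * K by ring.
apply: nrmD_le; [apply: nrmD_le; [apply: nrmD_le => //|]|].
- by rewrite nrmM i1 mul1r.
- by rewrite nrmM nn1 mul1r.
- by rewrite nrmM ni1 mul1r.
Qed.

(** A quarter turn multiplies the contribution of an edge by ['i * 'i^-1 ^+ 2 = 'i^-1], and the four
    powers of ['i^-1] add up to zero. *)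
Lemma square_sum_invsq n c :
  square_sum (fun z => z^-1 ^+ 2) n (corner c) (side c) = 0.
Proof.
rewrite square_sum_centered.
have rot (k z : C) : (k * z)^-1 ^+ 2 = k^-1 ^+ 2 * z^-1 ^+ 2 by rewrite invfM exprMn.
have i2 := sqr_i R.
rewrite (eq_edge_sum _ _ _ (rot 'i)) (eq_edge_sum _ _ _ (rot (-1))).
rewrite (eq_edge_sum _ _ _ (rot (- 'i))) !edge_sumM !exprVn !sqrrN !i2 expr1n.
by rewrite invrN1 invr1; ring.
Qed.

(** Here the factors are [k * k^-1 = 1], so the four edges contribute equally. On the lower edge the
    imaginary part of [z^-1] is [c / (x ^+ 2 + c ^+ 2)], at least [1 / (2 * c)], on a length of
    [2 * c]: each edge contributes at least 1. *)
Lemma square_sum_inv n c : 0 < c ->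
  4 <= nrm (square_sum (fun z => z^-1) n (corner c) (side c)).
Proof.
move=> c0; rewrite square_sum_centered.
have rot (k z : C) : (k * z)^-1 = k^-1 * z^-1 by rewrite invfM.
have i0 : ('i : C) != 0.
  by rewrite eq_complex /= oner_eq0 andbF.
rewrite (eq_edge_sum _ _ _ (rot 'i)) (eq_edge_sum _ _ _ (rot (-1))).
rewrite (eq_edge_sum _ _ _ (rot (- 'i))) !edge_sumM !mulrA.
rewrite !divff ?oppr_eq0 ?oner_eq0// !mul1r.
have := @edge_sum_Im_ge R (fun z => z^-1) n (corner c) (2 * c) (2 * c)^-1.
rewrite divff; last by rewrite mulf_neq0 ?gt_eqF.
move=> /(_ (mulr_ge0 (ler0n _ 2) (ltW c0))) Im1.
rewrite (le_trans _ (le_Im_nrm _))// (le_trans _ (ler_norm _))// !raddfD/=.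
suff {Im1}/Im1 : forall t : R, 0 <= t <= 1 ->
    (2 * c)^-1 <= complex.Im ((corner c + t%:C * (2 * c)%:C)^-1) by rewrite /side; lra.
move=> t /andP[t0 t1].
have -> : corner c + t%:C * side c = ((2 * t - 1) * c) +i* (- c) by cring.
have den : 0 < ((2 * t - 1) * c) ^+ 2 + (- c) ^+ 2 by rewrite ltr_wpDl ?sqr_ge0// sqrrN exprn_gt0.
rewrite /= mulNr opprK ler_pdivlMr// ler_pdivrMl ?mulr_gt0//.
have -> : ((2 * t - 1) * c) ^+ 2 + (- c) ^+ 2 = ((2 * t - 1) ^+ 2 + 1) * c ^+ 2 by ring.
have -> : 2 * c * c = 2 * c ^+ 2 by ring.
by rewrite ler_wpM2r ?sqr_ge0//; nra.
Qed.

Lemma vanishing_shift (u : nat -> C) j : vanishing u -> vanishing (fun n => u (n + j)%N).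
Proof.
by move=> hu e /hu[N uN]; exists N => n Nn; apply: uN; rewrite (leq_trans Nn)// leq_addr.
Qed.

(* Removing the twelve outer squares of the grid of mesh [rho / 2] halves the
   square, so the sum is compared with sums over arbitrarily small squares, where
   [f z = o(1 / z)]. *)
Lemma centered_vanishing f rho : 0 < rho ->
  (forall x y : R, `|x| <= rho -> `|y| <= rho -> x +i* y != 0 ->
     exists l, cderiv f (x +i* y) l) ->
  (forall e : R, 0 < e -> exists2 r : R, 0 < r &
     forall z, z != 0 -> nrm z < r -> nrm z * nrm (f z) <= e) ->
  vanishing (fun n => square_sum f n (corner rho) (side rho)).
Proof.
move=> rho0 df fo.
(* The cells of the grid on the centred square are those with [X] and [Y] among -2, -1, 0, 1; an
   index -2 or 1 keeps a closed cell away from zero. *)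
pose S c X Y n := square_sum f n ((X * (c / 2)) +i* (Y * (c / 2))) (c / 2)%:C.
pose W c n := square_sum f n (corner c) (side c).
have cE (x y u v : R) : x = u -> y = v -> x +i* y = u +i* v by move=> -> ->.
have quad c X Y n : square_sum f n.+1 ((X * (c / 2)) +i* (Y * (c / 2))) c%:C =
    S c X Y n + S c (X + 1) Y n + S c X (Y + 1) n + S c (X + 1) (Y + 1) n.
  rewrite square_sumS -real_complex_half /S.
  by congr (_ + _ + _ + _); congr square_sum; apply: cE => /=; field.
have W2 c n : W c n.+2 =
    square_sum f n.+1 ((- 2 * (c / 2)) +i* (- 2 * (c / 2))) c%:C +
    square_sum f n.+1 ((0 * (c / 2)) +i* (- 2 * (c / 2))) c%:C +
    square_sum f n.+1 ((- 2 * (c / 2)) +i* (0 * (c / 2))) c%:C +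
    square_sum f n.+1 ((0 * (c / 2)) +i* (0 * (c / 2))) c%:C.
  rewrite /W square_sumS /side -real_complex_half.
  have -> : 2 * c / 2 = c by field.
  by congr (_ + _ + _ + _); congr square_sum; apply: cE => /=; field.
have W1 c n : W (c / 2) n.+1 =
    square_sum f n.+1 ((- 1 * (c / 2)) +i* (- 1 * (c / 2))) c%:C.
  rewrite /W /side (_ : 2 * (c / 2) = c); last by field.
  by congr square_sum; apply: cE => /=; field.
have vS c X Y : 0 < c <= rho -> -2 <= X <= 1 -> -2 <= Y <= 1 ->
    [|| X == -2, X == 1, Y == -2 | Y == 1] -> vanishing (S c X Y).
  move=> /andP[c0 cr] /andP[X1 X2] /andP[Y1 Y2] XY.
  apply: goursat => s t /andP[s0 s1] /andP[t0 t1].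
  have -> : (X * (c / 2)) +i* (Y * (c / 2)) + (s +i* t) * (c / 2)%:C =
      ((X + s) * (c / 2)) +i* ((Y + t) * (c / 2)) by apply: cE => /=; field.
  have le2 w : -2 <= w <= 2 -> `|w * (c / 2)| <= rho.
    move=> w2; rewrite normrM (@ger0_norm _ (c / 2)); last by lra.
    have : `|w| <= 2 by rewrite ler_norml; lra.
    move=> /(ler_wpM2r (_ : 0 <= c / 2)) h; apply: le_trans (h _) _; lra.
  apply: df; [by apply: le2; lra|by apply: le2; lra|].
  have c2 : (c / 2 == 0) = false by rewrite gt_eqF//; lra.
  apply/eqP => -[/eqP]; rewrite mulf_eq0 c2 orbF => /eqP sX /eqP.
  rewrite mulf_eq0 c2 orbF => /eqP tY.
  by move: XY => /or4P[] /eqP ?; lra.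
(* Both sums reduce to cells at level [n], after two quarterings of the large square and one of the
   small square; the four inner cells cancel. *)
have diffW c : 0 < c <= rho -> vanishing (fun n => W c n.+2 - W (c / 2) n.+1).
  move=> cr; have vS' X Y := vS c X Y cr.
  have -> : (fun n => W c n.+2 - W (c / 2) n.+1) = (fun n =>
      S c (-2) (-2) n + S c (-2 + 1) (-2) n + S c (-2) (-2 + 1) n
    + (S c 0 (-2) n + S c (0 + 1) (-2) n + S c (0 + 1) (-2 + 1) n)
    + (S c (-2) 0 n + S c (-2) (0 + 1) n + S c (-2 + 1) (0 + 1) n)
    + (S c (0 + 1) 0 n + S c 0 (0 + 1) n + S c (0 + 1) (0 + 1) n)).
    apply/funext => n; rewrite W2 W1 !quad.
    have -> : -2 + 1 = -1 :> R by ring.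
    have -> : -1 + 1 = 0 :> R by ring.
    by ring.
  have half (x : R) : x = -2 \/ x = 1 \/ x = -1 \/ x = 0 -> -2 <= x <= 1.
    by move=> [|[|[|]]] ->; lra.
  have e1 : 0 + 1 = 1 :> R by rewrite add0r.
  have e2 : -2 + 1 = -1 :> R by ring.
  rewrite e1 e2; apply: vanishingD; [apply: vanishingD; [apply: vanishingD|]|];
    (apply: vanishingD; [apply: vanishingD|]); apply: vS'; rewrite ?eqxx ?orbT//; apply: half; tauto.
have iterW j : forall c, 0 < c <= rho ->
    vanishing (fun n => W c (n + j).+1 - W (c / 2 ^+ j) n.+1).
  elim: j => [|j IH] c /[dup] cr /andP[c0 c1].
    have -> : (fun n => W c (n + 0).+1 - W (c / 2 ^+ 0) n.+1) = fun=> 0.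
      by apply/funext => n; rewrite addn0 expr0 divr1 subrr.
    by move=> e e0; exists 0%N => n _; rewrite nrm0 ltW.
  have c2 : 0 < c / 2 <= rho by lra.
  have := vanishingD (vanishing_shift j (diffW c cr)) (IH _ c2).
  congr vanishing; apply/funext => n.
  by rewrite addrA subrK addnS exprS invfM mulrA.
(* On the small square [nrm z >= c], so [f] is at most [e / 16 / c] there, and the factor [8 * c] of
   the edges leaves [e / 2]. *)
move=> e e0; have [r r0 rf] := fo (e / 16) (divr_gt0 e0 (ltr0Sn _ 15)).
have [j jr] := exp2V_lt (2 * rho) r0.
set c := rho / 2 ^+ j.
have c0 : 0 < c by rewrite divr_gt0 ?exprn_gt0.
have cr : 2 * c < r by move: jr; rewrite /c; congr (_ < _); ring.
have [N NW] := iterW j rho ltac:(by rewrite rho0 lexx) _ (divr_gt0 e0 (ltr0Sn _ 1)).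
exists (N + j).+1 => -[//|n]; rewrite ltnS => Nn.
have jn : (j <= n)%N by rewrite (leq_trans _ Nn)// leq_addl.
have {NW} := NW (n - j)%N; rewrite leq_subRL// addnC => /(_ Nn); rewrite subnK// => h1.
rewrite [e]splitr -[square_sum _ _ _ _](subrK (W c (n - j).+1)) nrmD_le//.
have := @square_sum_centered_le f (n - j).+1 c (e / 16 / c) c0.
have -> : 8 * c * (e / 16 / c) = e / 2 by field; rewrite gt_eqF.
apply=> z /andP[cz z2]; have z0 : 0 < nrm z := lt_le_trans c0 cz.
rewrite ler_pdivlMr// (le_trans _ (rf z _ _))//.
- by rewrite mulrC ler_wpM2r// nrm_ge0.
- by apply: contraTneq z0 => ->; rewrite nrm0 ltxx.
- exact: le_lt_trans z2 cr.
Qed.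

(** The constant is the quotient of the bound [8 * rho * (M / rho ^+ 2)] on the sums of
    [f z / z ^+ 2] by the bound 4 for [z^-1]. *)
Lemma cauchy_estimate f rho M l : 0 < rho ->
  (forall x y : R, `|x| <= rho -> `|y| <= rho -> exists l, cderiv f (x +i* y) l) ->
  (forall z, nrm z <= 2 * rho -> nrm (f z) <= M) ->
  cderiv f 0 l -> nrm l <= 2 * M / rho.
Proof.
move=> rho0 df fM f0.
(* The sums of [z^-2] vanish by symmetry and those of [z^-1] stay away from zero,
   so the sums of [phi] isolate the coefficient [l]. *)
pose phi z := (f z - (f 0 + l * z)) * z^-1 ^+ 2.
have phiE : phi = fun z => f z * z^-1 ^+ 2 - (f 0 * z^-1 ^+ 2 - - l * z^-1).
  apply/funext => z; rewrite /phi; have [->|z0] := eqVneq z 0.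
    by rewrite invr0 expr0n; ring.
  by field.
have : vanishing (fun n => square_sum phi n (corner rho) (side rho)).
  apply: centered_vanishing => //.
    move=> x y hx hy z0; apply/cderivP; rewrite /phi.
    have /cderivP dfz := df _ _ hx hy.
    apply: (@differentiableM C C^o).
      by apply: differentiableB.
    by apply: (@differentiableM C C^o); apply: (@differentiableV C C^o).
  (* [z * phi z] is the difference quotient of [f] at zero minus [l], hence it tends to zero. *)
  move=> e e0; have [r r0 rP] := f0 _ e0; exists r => // z z0 zr.
  have z0' : 0 < nrm z by rewrite lt_def nrm_ge0 andbT; apply: contra_neq z0 => /nrm0_eq0.
  rewrite /phi nrmM nrmX nrmV.
  have -> : forall t : R, nrm z * (t * (nrm z)^-1 ^+ 2) = t / nrm z.
    by move=> t; field; rewrite gt_eqF.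
  rewrite ler_pdivrMr//.
  by have := rP z; rewrite subr0 opprD addrA => /(_ zr).
move=> van; apply/ler_addgt0Pr => e e0.
have [N /(_ N (leqnn N))] := van _ (mulr_gt0 (ltr0Sn _ 3) e0).
rewrite phiE !square_sumB !square_sumM square_sum_invsq mulr0 sub0r opprK.
set A := square_sum _ _ _ _; set B := square_sum _ _ _ _ => AB.
have Ale : nrm A <= 8 * M / rho.
  have -> : 8 * M / rho = 8 * rho * (M / rho ^+ 2) by field; rewrite gt_eqF.
  apply: square_sum_centered_le => // z /andP[z1 z2].
  rewrite nrmM nrmX nrmV ler_pM ?nrm_ge0 ?exprn_ge0 ?invr_ge0 ?nrm_ge0//; first exact: fM.
  have rz : (nrm z)^-1 <= rho^-1 by rewrite lef_pV2 ?posrE// (lt_le_trans rho0).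
  by rewrite -exprVn lerXn2r ?nnegrE ?invr_ge0 ?nrm_ge0 ?(ltW rho0).
have Bge : 4 <= nrm B := square_sum_inv N rho0.
have lB : nrm (l * B) <= 8 * M / rho + 4 * e.
  have -> : l * B = A - (A + - l * B) by ring.
  by apply: nrmD_le => //; rewrite nrmN.
have : nrm l * 4 <= 8 * M / rho + 4 * e.
  by rewrite (le_trans _ lB)// nrmM ler_wpM2l// nrm_ge0.
by move=> h; rewrite -(@ler_pM2r _ 4)// (le_trans h)//; lra.
Qed.

End cauchy_estimate.

(** * Uniform limits of differentiable functions *)

Section uniform_limits.
Variable R : realType.
Local Notation C := R[i].

(** If the increment over an interval exceeds [K'] times its length, so does the increment over one
    of its halves; at the limit point this contradicts the first-order expansion. *)
Lemma mean_value_complex (f : C -> C) (K : R) :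
  (forall t : R, 0 <= t <= 1 -> exists2 l, cderiv f t%:C l & nrm l <= K) ->
  nrm (f 1 - f 0) <= K.
Proof.
move=> df; rewrite leNgt; apply/negP => Klt.
(* [K'] is strictly between [K] and the increment: the gap [K' - K] pays for the error of the
   expansion. *)
pose K' := (K + nrm (f 1 - f 0)) / 2.
have KK' : K < K' by rewrite /K'; lra.
have K'lt : K' < nrm (f 1 - f 0) by rewrite /K'; lra.
have [||x [y xP]] := @dyadic_bisection R (fun k u _ =>
  K' * 2 ^- k < nrm (f (u + 2 ^- k)%:C - f u%:C)).
- by rewrite expr0 invr1 mulr1 add0r.
- move=> k u _ big; apply: contrapT => small; move: big.
  have {}small (b : bool) : nrm (f (u + b%:R * 2 ^- k.+1 + 2 ^- k.+1)%:C -
      f (u + b%:R * 2 ^- k.+1)%:C) <= K' * 2 ^- k.+1.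
    by rewrite leNgt; apply/negP => h; apply: small; exists b, false.
  have := small false; have := small true; rewrite mul1r mul0r addr0.
  move=> s1 s0; have := nrmB_le s1 s0; rewrite -addrA -mulrDr.
  have -> : 2 ^- k.+1 + 2 ^- k.+1 = 2 ^- k :> R by rewrite exprSr invfM -splitr.
  by move=> /le_lt_trans h /h; rewrite ltxx.
have x01 : 0 <= x <= 1.
  by have [x' [y' [_ [/andP[? ?] /andP[? ?]] _]]] := xP 0%N; lra.
have [l fl lK] := df _ x01.
have [r r0 flr] := fl (K' - K) ltac:(lra).
have [k kr] := exp2V_lt 1 r0; rewrite mulr1 in kr.
have [u [y' [big [/andP[_ ux] /andP[xu _]] _]]] := xP k.
move: big; apply/negP; rewrite -leNgt; set v := u + 2 ^- k.
have close (w : R) : `|w - x| <= 2 ^- k ->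
    nrm (f w%:C - f x%:C - l * (w - x)%:C) <= (K' - K) * `|w - x|.
  move=> wx; have := flr w%:C; rewrite -rmorphB nrm_real; apply.
  exact: le_lt_trans wx kr.
have p0 : 0 < 2 ^- k :> R by rewrite invr_gt0 exprn_gt0.
have -> : f v%:C - f u%:C = (f v%:C - f x%:C - l * (v - x)%:C) -
    (f u%:C - f x%:C - l * (u - x)%:C) + l * (v - u)%:C.
  by rewrite !rmorphB/=; ring.
have vu : `|v - u| = 2 ^- k by rewrite /v addrAC subrr add0r gtr0_norm.
have vx : `|v - x| = v - x by rewrite ger0_norm// subr_ge0.
have uxE : `|u - x| = x - u by rewrite distrC ger0_norm// subr_ge0.
have -> : K' * 2 ^- k = (K' - K) * (v - x) + (K' - K) * (x - u) + K * 2 ^- k.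
  by rewrite /v; ring.
apply: nrmD_le; [apply: nrmD_le|].
- by move: (close v); rewrite vx; apply; rewrite /v; lra.
- by rewrite nrmN; move: (close u); rewrite uxE; apply; lra.
- by rewrite nrmM nrm_real vu ler_wpM2r// ltW.
Qed.

Variable E : normedModType C.
Implicit Types (f G : E -> C^o) (x h : E).

Lemma cderiv_line f x h (z : C) : differentiable f (x + z *: h) ->
  cderiv (fun w : C => f (x + w *: h)) z ('d f (x + z *: h) h).
Proof.
move=> /differentiable_nrm df e e0.
have h0 : 0 < nrm h + 1 by rewrite ltr_wpDl// nrm_ge0.
have [r r0 rP] := df _ (divr_gt0 e0 h0).
exists (r / (nrm h + 1)); first by rewrite divr_gt0.
move=> w; rewrite ltr_pdivlMr// => wr.
have := rP ((w - z) *: h).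
rewrite -[x + _ + _]addrA -scalerDl [z + (w - z)]addrCA subrr addr0 linearZ/= nrmZ.
rewrite [_ * (w - z)]mulrC => wle.
apply: le_trans (wle _) _.
  by rewrite (le_lt_trans _ wr)// ler_wpM2l ?nrm_ge0// lerDl.
rewrite mulrAC ler_pdivrMr// -mulrA ler_wpM2l ?(ltW e0)//.
by rewrite ler_wpM2l ?nrm_ge0// lerDl.
Qed.

(** Cauchy's estimate on the complex line through [x] with direction [h] bounds the derivative at
    all parameters of the unit disc: zero gives the differential at [x], and the segment from 0 to 1
    gives the increment. *)
Lemma bounded_derivative f x h (r M : R) : 0 < r -> nrm h < r / 2 ->
  (forall k, nrm k < r -> differentiable f (x + k)) ->
  (forall k, nrm k < r -> nrm (f (x + k)) <= M) ->
  nrm ('d f x h) <= 8 * M / r * nrm h /\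
  nrm (f (x + h) - f x) <= 8 * M / r * nrm h.
Proof.
move=> r0 hr df fM.
have [->|hn0] := eqVneq h 0; first by rewrite linear0 addr0 subrr !nrm0 mulr0.
have h0 : 0 < nrm h by rewrite lt_def nrm_ge0 andbT; apply: contra_neq hn0 => /nrm0_eq0.
have bnd (c : C) : nrm c <= 1 -> nrm ('d f (x + c *: h) h) <= 8 * M / r * nrm h.
  (* With this radius [(1 + 2 * rho) * nrm h = nrm h + r / 2], which is less than [r]. *)
  move=> c1; pose rho := r / (4 * nrm h).
  have rho0 : 0 < rho by rewrite divr_gt0// mulr_gt0.
  have small (z : C) : nrm z <= 2 * rho -> nrm ((c + z) *: h) < r.
    move=> zr; rewrite nrmZ; have /(ler_wpM2r (ltW h0)) := nrmD_le c1 zr.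
    have -> : (1 + 2 * rho) * nrm h = nrm h + r / 2 by rewrite /rho; field; rewrite gt_eqF.
    by move=> /le_lt_trans; apply; lra.
  have -> : 8 * M / r * nrm h = 2 * M / rho by rewrite /rho; field; rewrite !gt_eqF.
  have line (z : C) : nrm z <= 2 * rho ->
      cderiv (fun w : C => f (x + (c + w) *: h)) z ('d f (x + (c + z) *: h) h).
    move=> /small/df/cderiv_line + e e0 => /(_ e e0)[s s0 sP].
    exists s => // w ws; have := sP (c + w).
    by rewrite opprD addrACA subrr add0r; apply.
  apply: (@cauchy_estimate _ (fun w : C => f (x + (c + w) *: h))) => //.
  - move=> u v hu hv; eexists; apply: line.
    by rewrite (le_trans (nrm_leReIm _))//= [2 * _]mulr_natl mulr2n lerD.
  - by move=> z /small/fM.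
  - by have := line 0; rewrite addr0 nrm0; apply; rewrite mulr_ge0// ltW.
split; first by have := bnd 0; rewrite scale0r addr0 nrm0; apply.
have := @mean_value_complex (fun w : C => f (x + w *: h)) (8 * M / r * nrm h).
rewrite scale1r scale0r addr0; apply => t /andP[t0 t1].
have t1' : nrm t%:C <= 1 by rewrite nrm_real ger0_norm.
exists ('d f (x + t%:C *: h) h); last exact: bnd.
apply/cderiv_line/df; rewrite nrmZ (@le_lt_trans _ _ (1 * nrm h))//.
  by rewrite ler_wpM2r// ltW.
by rewrite mul1r; lra.
Qed.

Lemma linear_bound_near0 (F : normedModType C) (L : {linear E -> F}) (s K : R) : 0 < s ->
  (forall h, nrm h < s -> nrm (L h) <= K * nrm h) ->
  forall h, nrm (L h) <= K * nrm h.
Proof.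
move=> s0 LK h; have h0 : 0 < nrm h + 1 by rewrite ltr_wpDl// nrm_ge0.
pose t := s / (nrm h + 1); have t0 : 0 < t by rewrite divr_gt0.
have := LK (t%:C *: h); rewrite linearZ/= !nrmZ nrm_real gtr0_norm// mulrCA.
rewrite ler_pM2l//; apply.
by rewrite mulrAC ltr_pdivrMr// ltr_pM2l// ltrDl.
Qed.

Lemma le0_harmonic (a c : R) : (forall n, a <= c * n.+1%:R^-1) -> a <= 0.
Proof.
move=> ac; rewrite leNgt; apply/negP => a0.
have c0 : 0 < c by have := lt_le_trans a0 (ac 0%N); rewrite invr1 mulr1.
have := ac (Num.truncn (c / a)); rewrite ler_pdivlMr// leNgt.
by rewrite mulrC -ltr_pdivrMr// truncnS_gt.
Qed.

(** The difference [f m - f n] is bounded by [2 * e n] near [x], so [bounded_derivative] controls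
    both its differential and its increments by a multiple of [e n * nrm h]. The first makes the
    differentials converge, the second lets the expansion of a single [f n] pass to [G]. *)
Lemma uniform_limit_differentiable G x (r : R) : 0 < r ->
  (forall e : R, 0 < e -> exists f : E -> C^o, forall h, nrm h < r ->
     differentiable f (x + h) /\ nrm (G (x + h) - f (x + h)) <= e) ->
  differentiable G x.
Proof.
move=> r0 approx.
pose e n : R := n.+1%:R^-1.
have e0 n : 0 < e n by rewrite invr_gt0.
have [f fP] := choice (fun n => approx (e n) (e0 n)).
have df n h : nrm h < r -> differentiable (f n) (x + h) by move=> /(fP n)[].
have Gf n h : nrm h < r -> nrm (G (x + h) - f n (x + h)) <= e n by move=> /(fP n)[].
have e_le n m : (n <= m)%N -> e m <= e n.
  by move=> nm; rewrite lef_pV2 ?posrE// ler_nat.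
have df0 n : differentiable (f n) x by have := df n 0; rewrite nrm0 addr0; apply.
pose D n := 'd (f n) x.
pose K := 16 / r.
have K0 : 0 < K by rewrite divr_gt0.
have close n m h : (n <= m)%N -> nrm h < r / 2 ->
    nrm (D m h - D n h) <= K * e n * nrm h /\
    nrm (f m (x + h) - f n (x + h) - (f m x - f n x)) <= K * e n * nrm h.
  move=> nm hr; have -> : K * e n = 8 * (2 * e n) / r by rewrite /K; ring.
  have dE : 'd (f m - f n) x h = D m h - D n h.
    exact: (congr1 (fun T : E -> C^o => T h) (diffB (df0 m) (df0 n))).
  rewrite -dE; apply: (@bounded_derivative (f m - f n) x h r (2 * e n) r0 hr) => k kr.
    exact: differentiableB (df m k kr) (df n k kr).
  have -> : (f m - f n) (x + k) = f m (x + k) - f n (x + k) by [].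
  have fmG : nrm (f m (x + k) - G (x + k)) <= e n.
    by rewrite nrmB; exact: le_trans (Gf _ _ kr) (e_le _ _ nm).
  by rewrite mulr_natl mulr2n; exact: nrmB_le fmG (Gf _ _ kr).
have closeD n m h : (n <= m)%N -> nrm (D m h - D n h) <= K * e n * nrm h.
  move=> nm.
  have /= := @linear_bound_near0 _ (D m \- D n : {linear E -> C^o}) (r / 2) (K * e n).
  apply; first by rewrite divr_gt0.
  by move=> k /(close _ _ _ nm)[].
have cauchyD h : exists l : C, forall eps : R, 0 < eps -> exists N, forall n,
    (N <= n)%N -> nrm (D n h - l) <= eps.
  apply: complex_cauchy => eps eps0; apply: contrapT => no.
  have : eps <= 0.
    apply: (@le0_harmonic _ (K * nrm h)) => n; rewrite leNgt; apply/negP => lt.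
    apply: no; exists n => m nm; apply: le_trans (closeD n m h nm) _.
    by rewrite mulrAC ltW.
  by rewrite leNgt eps0.
have [L LP] := choice cauchyD.
have DL n h : nrm (D n h - L h) <= K * e n * nrm h.
  apply/ler_addgt0Pr => eps eps0; have [N NP] := LP h _ eps0.
  apply: (@nrmB_le _ _ _ (D (maxn n N) h)).
    by rewrite nrmB; apply: closeD; rewrite leq_maxl.
  by apply: NP; rewrite leq_maxr.
have linL : linear (L : E -> C^o).
  move=> a h k; apply/subr0_eq/nrm0_eq0/eqP; rewrite eq_le nrm_ge0 andbT.
  apply: (@le0_harmonic _ (K * (nrm (a *: h + k) + nrm a * nrm h + nrm k))) => n.
  have -> : L (a *: h + k) - (a *: L h + L k) =
      - (D n (a *: h + k) - L (a *: h + k)) + a * (D n h - L h) + (D n k - L k).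
    have -> : D n (a *: h + k) = a * (D n h : C) + D n k :> C by rewrite linearP.
    have -> : a *: L h = a * L h by [].
    by move: (L (a *: h + k)) (D n h : C) (D n k : C) (L h) (L k) => *; ring.
  have -> : K * (nrm (a *: h + k) + nrm a * nrm h + nrm k) / n.+1%:R =
     K * e n * nrm (a *: h + k) + nrm a * (K * e n * nrm h) + K * e n * nrm k.
    by rewrite /e; ring.
  apply: nrmD_le => //; apply: nrmD_le; first by rewrite nrmN.
  by rewrite nrmM ler_wpM2l// nrm_ge0.
pose L' : {linear E -> C^o} := HB.pack (L : E -> C^o)
  (GRing.isLinear.Build _ _ _ _ _ linL).
have contL : continuous L'.
  apply/linear_bounded_continuous/linear_boundedP.
  have /linear_boundedP : bounded_near (D 0%N) (nbhs (0 : E)).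
    by apply/linear_bounded_continuous; apply: diff_continuous.
  move=> /pinfty_ex_gt0[M /gt0_complexP[-> M0] DM].
  near=> B => h; rewrite (@le_trans _ _ ((complex.Re M + K)%:C * `|h|))//.
    rewrite !nrmE -rmorphM lecR mulrDl -[L' h](subrK (D 0%N h)) addrC.
    apply: nrmD_le; last by rewrite nrmB (le_trans (DL 0%N h))// /e invr1 mulr1.
    by have := DM h; rewrite !nrmE -rmorphM lecR.
  rewrite ler_wpM2r//; near: B; apply: nbhs_pinfty_ge.
  by rewrite realE ler0c addr_ge0// ltW.
apply: (nrm_differentiable (L := L')) => // eps eps0.
have [n nP] : exists n, 2 * K * e n <= eps / 2.
  apply: contrapT => no; have : eps / 2 <= 0.
    apply: (@le0_harmonic _ (2 * K)) => n; rewrite leNgt; apply/negP => lt.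
    by apply: no; exists n; rewrite ltW.
  by lra.
have [s s0 sP] := differentiable_nrm (df0 n) (divr_gt0 eps0 (ltr0Sn _ 1)).
exists (Num.min s (r / 2)); first by rewrite lt_min s0 divr_gt0.
move=> h; rewrite lt_min => /andP[/sP hs hr].
have hr' : nrm h < r by lra.
(* The differentiability of [G] is the goal, so the bound comes from [f m - f n]; for fixed [h] the
   remaining error [2 * e m] is arbitrarily small. *)
have Gfn : nrm (G (x + h) - f n (x + h) - (G x - f n x)) <= K * e n * nrm h.
  apply/ler_addgt0Pr => d d0.
  have [m nm md] : exists2 m, (n <= m)%N & 2 * e m <= d.
    apply: contrapT => no; have : d <= 0.
      apply: (@le0_harmonic _ 2) => m; rewrite leNgt; apply/negP => lt.
      apply: no; exists (maxn n m); rewrite ?leq_maxl// (le_trans _ (ltW lt))//.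
      by rewrite ler_pM2l// e_le// leq_maxr.
    by rewrite leNgt d0.
  have -> : G (x + h) - f n (x + h) - (G x - f n x) =
     (f m (x + h) - f n (x + h) - (f m x - f n x)) +
     ((G (x + h) - f m (x + h)) - (G x - f m x)).
    by move: (f n _ : C) (f n _ : C) (f m _ : C) (f m _ : C) (G x : C) (G _ : C) => *; ring.
  apply: nrmD_le; first by have [] := close n m h nm hr.
  rewrite (le_trans _ md)// mulr_natl mulr2n; apply: nrmD_le; first exact: Gf.
  by rewrite nrmN -[x]addr0 Gf// nrm0.
have -> : G (x + h) - G x - L' h = (G (x + h) - f n (x + h) - (G x - f n x)) +
    (f n (x + h) - f n x - D n h) + (D n h - L h).
  have -> : L' h = L h by [].
  by move: (G _ : C) (f n _ : C) (G _ : C) (f n _ : C) (D n h : C) (L h) => *; ring.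
have -> : eps * nrm h = (eps / 2 - 2 * K * e n) * nrm h + (K * e n * nrm h +
  (eps / 2) * nrm h + K * e n * nrm h) by field.
rewrite -[nrm _]add0r lerD//; first by rewrite mulr_ge0 ?nrm_ge0// subr_ge0.
by apply: nrmD_le => //; apply: nrmD_le.
Unshelve. all: by end_near. Qed.

End uniform_limits.

(** * The weak* topology and bounded families *)

Section weak_star_topology.
Variables (R : realType) (X : normedModType R[i]).
Local Notation C := R[i].
Implicit Types (B : set (dual X)) (V : set (dual X)) (w y : dual X).

Definition weak_star_box (xs : seq X) (e : R) y : set (dual X) :=
  [set w | forall x, x \in xs -> nrm (w x - y x) < e].

Lemma nbhs_weak_starP y V : @nbhs _ (weak_star X) y V <->
  exists xs, exists2 e : R, 0 < e & weak_star_box xs e y `<=` V.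
Proof.
split.
  (* [F] is generated by the boxes around [y] in the full function space; its pointwise convergence
     to [y] says that every neighbourhood of [y] contains a box. *)
  pose F : set_system (X -> C^o) := [set S | exists xs : seq X, exists2 e : R, 0 < e &
    forall g : X -> C^o, (forall x, x \in xs -> nrm (g x - y x) < e) -> S g].
  have FF : Filter F.
    split.
    - by exists [::], 1.
    - move=> S T [xs [e e0 eS]] [ys [d d0 dT]].
      exists (xs ++ ys), (Num.min e d); first by rewrite lt_min e0.
      move=> g ge; split; [apply: eS|apply: dT] => x xin.
        by have := ge x; rewrite mem_cat xin lt_min => /(_ isT)/andP[].
      by have := ge x; rewrite mem_cat xin orbT lt_min => /(_ isT)/andP[].
    - by move=> S T ST [xs [e e0 eS]]; exists xs, e => // g /eS /ST.
  have Fy : {ptws, F --> (y : X -> C^o)}.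
    apply/pointwise_cvgP => x S /nbhs_nrmP[e e0 eS].
    by exists [:: x], e => // g /(_ x (mem_head _ _)) /eS.
  rewrite nbhsE => -[A [[A' A'o <-] A'y] AV].
  have /Fy[xs [e e0 eA]] : nbhs (y : {ptws X -> C^o}) A' by apply: open_nbhs_nbhs.
  by exists xs, e => // w wy; apply: AV; apply: eA.
move=> [xs [e e0 eV]]; apply: (@filterS _ (@nbhs _ (weak_star X) y)) eV _.
have eval x : @nbhs _ (weak_star X) y [set w : dual X | nrm (w x - y x) < e].
  have : {ptws, nbhs (y : {ptws X -> C^o}) --> (y : X -> C^o)} by exact: cvg_id.
  move=> /pointwise_cvgP/(_ x) yx.
  have /yx : nbhs (y x : C^o) [set c : C^o | nrm (c - y x) < e].
    by apply/nbhs_nrmP; exists e.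
  exact: (@initial_continuous (dual X) {ptws X -> C^o} (@dual_fun R X) y).
elim: xs => [|x xs IH].
  by apply: (@filterS _ (@nbhs _ (weak_star X) y) _ setT); [move=> ? _ ?|exact: filterT].
apply: (@filterS _ (@nbhs _ (weak_star X) y) _ _ _ _ (filterI (eval x) IH)).
by move=> w [wx wxs] z; rewrite inE => /orP[/eqP->//|/wxs].
Qed.

Lemma weak_star_closureP B y : weak_star_closure B y <->
  forall xs (e : R), 0 < e -> exists2 w, B w & weak_star_box xs e y w.
Proof.
split.
  move=> By xs e e0; have [|w [Bw wy]] := By (weak_star_box xs e y); last by exists w.
  by apply/nbhs_weak_starP; exists xs, e.
move=> H V /nbhs_weak_starP[xs [e e0 eV]].
by have [w Bw /eV Vw] := H xs e e0; exists w.
Qed.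

Lemma weak_star_closureS A B : A `<=` B -> weak_star_closure A `<=` weak_star_closure B.
Proof.
move=> AB y /weak_star_closureP h; apply/weak_star_closureP => xs e e0.
by have [w /AB Bw ?] := h xs e e0; exists w.
Qed.

Lemma sub_weak_star_closure B : B `<=` weak_star_closure B.
Proof.
by move=> y By; apply/weak_star_closureP => xs e e0; exists y => // x _; rewrite subrr nrm0.
Qed.

Lemma weak_star_unif_continuousP B (f : dual X -> C^o) :
  weak_star_unif_continuous_on B f <->
  forall e : R, 0 < e -> exists xs, exists2 d : R, 0 < d &
    forall w y, B w -> B y -> weak_star_box xs d y w -> nrm (f w - f y) <= e.
Proof.
split=> H e e0.
  have e0' : 0 < e%:C :> C by rewrite ltcR.
  have [V /nbhs_weak_starP[xs [d d0 dV]] VP] := H _ e0'.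
  exists xs, d => // w y Bw By wy.
  rewrite -lecR -nrmE ltW// VP//; apply: dV => x xin.
  by rewrite subr0; apply: wy.
have [-> er0] := gt0_complexP e0.
have [xs [d d0 dP]] := H _ (divr_gt0 er0 (ltr0Sn _ 1)).
exists (weak_star_box xs d (0 : dual X)).
  by apply/nbhs_weak_starP; exists xs, d.
move=> w y Bw By wy; rewrite nrmE ltcR.
apply: le_lt_trans (dP w y Bw By _) _; last by rewrite ltr_pdivrMr// ltr_pMr// ltr1n.
by move=> x /wy; rewrite subr0.
Qed.

Lemma nrm_dual_le (w : dual X) x : nrm (w x) <= nrm w * nrm x.
Proof. by rewrite -lecR rmorphM/= -!nrmE; exact: le_dual_norm. Qed.

Lemma dual_nrm_le (w : dual X) (M : R) :
  (forall x, nrm x <= 1 -> nrm (w x) <= M) -> nrm w <= M.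
Proof.
move=> wM; rewrite -lecR -nrmE; apply: dual_norm_le => x.
by rewrite nrmE -[1]/(1%:C) lecR => /wM; rewrite nrmE lecR.
Qed.

Lemma weak_star_closure_ball B M : (forall w, B w -> nrm w <= M) ->
  forall y, weak_star_closure B y -> nrm y <= M.
Proof.
move=> BM y /weak_star_closureP By; apply: dual_nrm_le => x x1.
apply/ler_addgt0Pr => e e0.
have [w Bw /(_ x (mem_head _ _)) wy] := By [:: x] e e0.
rewrite addrC -[y x](subrK (w x)); apply: nrmD_le; first by rewrite nrmB ltW.
rewrite (le_trans (nrm_dual_le _ _))// (le_trans _ (BM w Bw))//.
by rewrite ler_piMr// nrm_ge0.
Qed.

Lemma bounded_setP B : bounded_set B <->
  exists2 M : R, 0 < M & forall w, B w -> nrm w <= M.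
Proof.
split.
  move=> /pinfty_ex_gt0[M /gt0_complexP[-> M0] BM].
  by exists (complex.Re M) => // w Bw; rewrite -lecR -nrmE; exact: BM.
move=> [M M0 BM]; exists M%:C; split; first by rewrite realE ler0c (ltW M0).
move=> r Mr w Bw /=; rewrite (le_trans _ (ltW Mr))//.
by rewrite nrmE lecR BM.
Qed.

Lemma U_boundedP U B : U_bounded U B <->
  exists2 M : R, 0 < M & exists2 r : R, 0 < r & forall w, B w ->
    nrm w <= M /\ forall h, nrm h < r -> U (w + h).
Proof.
split.
  move=> [BU /bounded_setP[M M0 BM] [r /gt0_complexP[-> r0] rP]].
  exists M => //; exists (complex.Re r) => // w Bw; split; first exact: BM.
  move=> h hr; apply: contrapT => nU; have := rP _ _ Bw nU.
  by rewrite nrmE lecR opprD addrA subrr add0r nrmN leNgt hr.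
move=> [M M0 [r r0 H]]; split.
- by move=> w /H[_ /(_ 0)]; rewrite nrm0 addr0; apply.
- by apply/bounded_setP; exists M => // w /H[].
- exists r%:C; first by rewrite ltcR.
  move=> w y /H[_ wU] nUy; rewrite nrmE lecR leNgt; apply/negP => wy; apply: nUy.
  by have := wU (y - w); rewrite nrmB [w + _]addrC subrK; apply.
Qed.

Definition nrm_fattened A B := exists2 r : R, 0 < r &
  forall w h, A w -> nrm h < r -> B (w + h).

Lemma nrm_fattenedP (A B : set (dual X)) : nrm_fattened A B <->
  exists2 r : C, 0 < r & [set w + r *: h | w in A & h in ball (0 : dual X) 1] `<=` B.
Proof.
split=> [[r r0 rP]|[r /gt0_complexP[-> r0] rP]].
  exists r%:C; first by rewrite ltcR.
  move=> _ [w Aw [h h1 <-]]; apply: rP => //.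
  move: h1; rewrite -ball_normE/= sub0r normrN nrmE -[1]/(1%:C) ltcR => h1.
  by rewrite nrmZ nrm_real gtr0_norm// gtr_pMr.
exists (complex.Re r) => // w h Aw hr; apply: rP.
have rC0 : (complex.Re r)%:C != 0 :> C by rewrite -(rmorph0 (real_complex R)) (inj_eq (@complexI R)) gt_eqF.
exists w => //; exists ((complex.Re r)%:C^-1 *: h); last by rewrite scalerA divff// scale1r.
rewrite -ball_normE/= sub0r normrN nrmE -[1]/(1%:C) ltcR nrmZ nrmV nrm_real gtr0_norm//.
by rewrite mulrC ltr_pdivrMr// mul1r.
Qed.

(** Translation by [h] preserves boxes, so the radius is unchanged. *)
Lemma nrm_fattened_closure (A B : set (dual X)) : nrm_fattened A B ->
  nrm_fattened (weak_star_closure A) (weak_star_closure B).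
Proof.
move=> [r r0 rP]; exists r => // y h /weak_star_closureP Ay hr.
apply/weak_star_closureP => xs e e0; have [w Aw wy] := Ay xs e e0.
exists (w + h); first exact: rP.
by move=> x /wy; rewrite !dualD opprD addrACA subrr addr0.
Qed.

End weak_star_topology.

(** * Extension by weak* limits *)

Section extension.
Variables (R : realType) (X : normedModType R[i]).
Local Notation C := R[i].
Implicit Types (U A B : set (dual X)) (f g : dual X -> C^o) (w y : dual X).

Lemma weak_star_box_weaken (xs ys : seq X) (d e : R) y w :
  {subset xs <= ys} -> e <= d -> weak_star_box ys e y w -> weak_star_box xs d y w.
Proof. by move=> xy ed h x /xy /h /lt_le_trans; apply. Qed.

Lemma weak_star_box_trans (xs : seq X) (d e : R) u v w :
  weak_star_box xs d v u -> weak_star_box xs e w v -> weak_star_box xs (d + e) w u.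
Proof.
move=> uv vw x xin; rewrite -(subrK (v x) (u x)) -addrA.
by rewrite (le_lt_trans (nrmD _ _))// ltrD ?uv ?vw.
Qed.

Lemma weak_star_box_sym (xs : seq X) (d : R) u v :
  weak_star_box xs d v u -> weak_star_box xs d u v.
Proof. by move=> h x /h; rewrite nrmB. Qed.

Definition weak_star_limit f B y (l : C) := forall e : R, 0 < e ->
  exists xs, exists2 d : R, 0 < d &
    forall w, B w -> weak_star_box xs d y w -> nrm (f w - l : C) <= e.

Lemma weak_star_limitS f A B y l : A `<=` B ->
  weak_star_limit f B y l -> weak_star_limit f A y l.
Proof.
move=> AB lB e /lB[xs [d d0 dP]]; exists xs, d => // w /AB; exact: dP.
Qed.

Lemma weak_star_limit_unique f B y l l' : weak_star_closure B y ->
  weak_star_limit f B y l -> weak_star_limit f B y l' -> l = l'.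
Proof.
move=> /weak_star_closureP By lf lf'; apply/subr0_eq/nrm0_eq0/eqP.
rewrite eq_le nrm_ge0 andbT; apply/ler_addgt0Pr => e e0; rewrite add0r.
have e2 : 0 < e / 2 by rewrite divr_gt0.
have [xs [d d0 dP]] := lf _ e2; have [ys [c c0 cP]] := lf' _ e2.
have [|w Bw wy] := By (xs ++ ys) (Num.min d c); first by rewrite lt_min d0.
rewrite [e]splitr; apply: (@nrmB_le _ _ _ (f w : C)).
  rewrite nrmB dP//; apply: weak_star_box_weaken wy; last by rewrite ge_min lexx.
  by move=> x; rewrite mem_cat => ->.
rewrite cP//; apply: weak_star_box_weaken wy; last by rewrite ge_min lexx orbT.
by move=> x; rewrite mem_cat => ->; rewrite orbT.
Qed.

Lemma weak_star_limit_self f B y : B y -> weak_star_unif_continuous_on B f ->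
  weak_star_limit f B y (f y).
Proof.
move=> By /weak_star_unif_continuousP fB e /fB[xs [d d0 dP]].
by exists xs, d => // w Bw wy; exact: dP.
Qed.

(** Countably many moduli of continuity, one for each [n.+1%:R^-1], suffice to define the limit: the
    point [u n] of [B] obeys the first [n.+1] of them near [y], which makes the values Cauchy
    although the points need not converge. *)
Lemma weak_star_limit_ex f B y : weak_star_unif_continuous_on B f ->
  weak_star_closure B y -> exists l, weak_star_limit f B y l.
Proof.
move=> /weak_star_unif_continuousP fB /weak_star_closureP By.
have e0 n : 0 < n.+1%:R^-1 :> R by rewrite invr_gt0.
have /choice[s sP] : forall n, exists p : seq X * R, 0 < p.2 /\
    forall w w', B w -> B w' -> weak_star_box p.1 p.2 w' w ->
      nrm (f w - f w') <= n.+1%:R^-1.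
  by move=> n; have [xs [d d0 dP]] := fB _ (e0 n); exists (xs, d).
(* Half the radius, because two points near [y] are compared with each other. *)
pose near n w := weak_star_box (s n).1 ((s n).2 / 2) y w.
have nearP n w w' : B w -> B w' -> near n w -> near n w' ->
    nrm (f w - f w') <= n.+1%:R^-1.
  move=> Bw Bw' wn wn'; have [d0 dP] := sP n; apply: dP => //.
  by rewrite [(s n).2]splitr; apply: weak_star_box_trans wn (weak_star_box_sym wn').
have common n : exists xs, exists2 d : R, 0 < d &
    forall w, weak_star_box xs d y w -> forall k, (k <= n)%N -> near k w.
  elim: n => [|n [xs [d d0 IH]]].
    exists (s 0%N).1, ((s 0%N).2 / 2); first by rewrite divr_gt0//; case: (sP 0%N).
    by move=> w wy k; rewrite leqn0 => /eqP->.
  exists (xs ++ (s n.+1).1), (Num.min d ((s n.+1).2 / 2)).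
    by rewrite lt_min d0 divr_gt0//; case: (sP n.+1).
  move=> w wy k; rewrite leq_eqVlt => /orP[/eqP->|].
    apply: weak_star_box_weaken wy; last by rewrite ge_min lexx orbT.
    by move=> x; rewrite mem_cat => ->; rewrite orbT.
  rewrite ltnS; apply: IH; apply: weak_star_box_weaken wy; last by rewrite ge_min lexx.
  by move=> x; rewrite mem_cat => ->.
have /choice[u uP] : forall n, exists w, B w /\ forall k, (k <= n)%N -> near k w.
  move=> n; have [xs [d d0 dP]] := common n; have [w Bw wy] := By xs d d0.
  by exists w; split=> //; exact: dP.
have small (e : R) : 0 < e -> exists n, n.+1%:R^-1 <= e.
  move=> ep; apply: contrapT => no; have : e <= 0.
    apply: (@le0_harmonic _ e 1) => n; rewrite mul1r leNgt; apply/negP => lt.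
    by apply: no; exists n; rewrite ltW.
  by rewrite leNgt ep.
have [|l lP] := @complex_cauchy R (fun n => f (u n)).
  move=> e /small[N Ne]; exists N => n Nn; apply: le_trans Ne.
  by apply: nearP; [case: (uP n)|case: (uP N)|case: (uP n) => _; apply|case: (uP N) => _; apply].
exists l => e ep; have e2 : 0 < e / 2 by rewrite divr_gt0.
have [n ne] := small _ e2; have [N NP] := lP _ e2.
exists (s n).1, ((s n).2 / 2); first by rewrite divr_gt0//; case: (sP n).
move=> w Bw wy; rewrite [e]splitr; apply: (@nrmB_le _ _ _ (f (u (maxn n N)) : C)).
  apply: le_trans ne; apply: nearP => //; first by case: (uP (maxn n N)).
  by case: (uP (maxn n N)) => _; apply; rewrite leq_maxl.
by apply: NP; rewrite leq_maxr.
Qed.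

Lemma differentiable_shift (E F : normedModType C) (f : E -> F) (c x : E) :
  differentiable f (x + c) -> differentiable (fun z => f (z + c)) x.
Proof.
move=> fx; apply: (nrm_differentiable (L := 'd f (x + c))).
  exact: diff_continuous.
move=> e /(differentiable_nrm fx)[r r0 rP]; exists r => // h hr.
by rewrite [x + h + c]addrAC; exact: rP.
Qed.

Lemma fundamental_familyS U (B : (set (dual X))^nat) n : fundamental_family U B ->
  nrm_fattened (B n) (B n.+1).
Proof. by move=> [_ _ /(_ n)]; rewrite -nrm_fattenedP. Qed.

Lemma nrm_fattened_sub A B : nrm_fattened A B -> A `<=` B.
Proof. by move=> [r r0 rP] w Aw; rewrite -[w]addr0; apply: rP => //; rewrite nrm0. Qed.

Lemma fundamental_family_mono U (B : (set (dual X))^nat) m n : (m <= n)%N ->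
  fundamental_family U B -> B m `<=` B n.
Proof.
move=> mn famB; rewrite -(subnK mn); elim: (n - m)%N => //= d IH w /IH.
by rewrite addSn; exact: (nrm_fattened_sub (fundamental_familyS _ famB)).
Qed.

Lemma U_bounded1 U y : open U -> U y -> U_bounded U [set y].
Proof.
move=> Uo Uy; apply/U_boundedP.
have /nbhs_nrmP[r r0 rP] : nbhs y U by exact: open_nbhs_nbhs.
exists (nrm y + 1); first by rewrite ltr_wpDl// nrm_ge0.
exists r => // _ ->; split; first by rewrite lerDl.
by move=> h hr; apply: rP; rewrite addrAC subrr add0r.
Qed.

Lemma boundedly_regular_extension U f : open U -> boundedly_regular U -> Hwsu U f ->
  exists2 g, Hwsu (envelope U) g & forall x, U x -> g x = f x.
Proof.
move=> Uo [B famB famE] [fhol fuc].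
have [BU Babs _] := famB; have [EU Eabs _] := famE.
have fB n : weak_star_unif_continuous_on (B n) f by exact: fuc.
have inE y : envelope U y -> exists n, weak_star_closure (B n) y.
  move=> [A /Babs[n An] Ay]; exists n; exact: weak_star_closureS Ay.
(* The sets [B n] increase, so limits along different [B n] agree by uniqueness; off all the
   closures the value is 0. *)
have /choice[g gP] : forall y, exists l : C^o,
    forall n, weak_star_closure (B n) y -> weak_star_limit f (B n) y l.
  move=> y; have [[n0 yn0]|no] := pselect (exists n, weak_star_closure (B n) y); last first.
    by exists 0 => n yn; case: no; exists n.
  have [l lP] := weak_star_limit_ex (fB n0) yn0; exists l => n yn.
  have [nn0|/ltnW n0n] := leqP n n0.
    by apply: weak_star_limitS lP; exact: fundamental_family_mono famB.
  have [l' lP'] := weak_star_limit_ex (fB n) yn.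
  rewrite (weak_star_limit_unique yn0 lP (_ : weak_star_limit _ _ _ l'))//.
  by apply: weak_star_limitS lP'; exact: fundamental_family_mono famB.
have gf y : U y -> g y = f y.
  move=> Uy; have [n /(_ y erefl) By] := Babs _ (U_bounded1 Uo Uy).
  have By' : weak_star_closure (B n) y by exact: sub_weak_star_closure.
  exact: (weak_star_limit_unique By' (gP _ _ By') (weak_star_limit_self By (fB n))).
have guc n : weak_star_unif_continuous_on (weak_star_closure (B n)) g.
  apply/weak_star_unif_continuousP => e ep.
  have e3 : 0 < e / 3 by rewrite divr_gt0.
  have /weak_star_unif_continuousP/(_ _ e3)[xs [d d0 dP]] := fB n.
  have d3 : 0 < d / 3 by rewrite divr_gt0.
  exists xs, (d / 3) => // y y' cly cly' yy'.
  have approx z : weak_star_closure (B n) z -> exists w, [/\ B n w,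
      weak_star_box xs (d / 3) z w & nrm (f w - g z) <= e / 3].
    move=> clz; have [ys [c c0 cP]] := gP _ _ clz _ e3.
    have /weak_star_closureP/(_ (xs ++ ys) (Num.min (d / 3) c)) := clz.
    rewrite lt_min d3 c0 => /(_ isT)[w Bw wz]; exists w; split=> //.
      apply: weak_star_box_weaken wz; last by rewrite ge_min lexx.
      by move=> x; rewrite mem_cat => ->.
    apply: cP => //; apply: weak_star_box_weaken wz; last by rewrite ge_min lexx orbT.
    by move=> x; rewrite mem_cat => ->; rewrite orbT.
  have [w [Bw wy fw]] := approx _ cly; have [w' [Bw' wy' fw']] := approx _ cly'.
  have -> : e = e / 3 + (e / 3 + e / 3) by field.
  apply: (@nrmB_le _ _ _ (f w)); first by rewrite nrmB.
  apply: (@nrmB_le _ _ _ (f w')); last exact: fw'.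
  apply: dP => //; have -> : d = d / 3 + (d / 3 + d / 3) by field.
  apply: weak_star_box_trans wy _.
  exact: weak_star_box_trans yy' (weak_star_box_sym wy').
exists g => //; split; last first.
  move=> A /Eabs[n An] e /guc-/(_ n)[V V0 VP]; exists V => // x y Ax Ay.
  by apply: VP; exact: An.
move=> y /inE[n yn].
have [r r0 rP] := fundamental_familyS n famB.
have [s s0 sP] := nrm_fattened_closure (fundamental_familyS n famB).
apply: (@uniform_limit_differentiable _ _ _ _ (Num.min r s)); first by rewrite lt_min r0.
move=> e ep; have /weak_star_unif_continuousP/(_ _ ep)[xs [d d0 dP]] := guc n.+1.
have /weak_star_closureP/(_ xs d d0)[w Bw wy] := yn.
(* The translation carries a ball around [y] to a ball around [w] inside [U]. Since [y + h] and
   [w + h] differ by [y - w] for every [h], uniform continuity on the closure of [B n.+1] gives an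
   error uniform in [h]. *)
exists (fun z => f (z + (w - y))) => h; rewrite lt_min => /andP[hr hs].
have yhw : y + h + (w - y) = w + h by rewrite [y + h]addrC addrACA subrr addr0 addrC.
have BUn : B n.+1 `<=` U by case: (BU n.+1).
split; first by apply: differentiable_shift; rewrite yhw; apply/fhol/BUn/rP.
rewrite yhw -gf; last by apply/BUn/rP.
apply: dP; [exact: sP|by apply: sP => //; exact: sub_weak_star_closure|].
by apply: weak_star_box_sym => x /wy; rewrite !dualD opprD addrACA subrr addr0.
Qed.

End extension.

(** * Absolutely convex sets and separation *)

Section absolutely_convex_sets.
Variables (R : realType) (X : normedModType R[i]).
Local Notation C := R[i].
Implicit Types (U A B W : set (dual X)) (w y u v : dual X).

Lemma absolutely_convexP U a b u v : absolutely_convex U ->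
  nrm (a : C) + nrm (b : C) <= 1 -> U u -> U v -> U (a *: u + b *: v).
Proof.
by move=> Uac ab; apply: Uac; rewrite !nrmE -rmorphD -(rmorph1 (real_complex R)) lecR.
Qed.

Lemma absolutely_convexZ U (a : C) u : absolutely_convex U -> nrm a <= 1 -> U u -> U (a *: u).
Proof.
move=> Uac a1 Uu; rewrite -[a *: u]addr0 -(scale0r u).
by apply: absolutely_convexP => //; rewrite nrm0 addr0.
Qed.

(** By convexity [s U + (t - s) U] lies in [t U], and [(t - s) U] contains the ball of radius
    [(t - s) * rho]. *)
Lemma absolutely_convex_dilate U (rho s t : R) u h : absolutely_convex U ->
  (forall v, nrm v < rho -> U v) -> 0 <= s -> s < t -> U u ->
  nrm h < (t - s) * rho -> exists2 v, U v & s%:C *: u + h = t%:C *: v.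
Proof.
move=> Uac Ub s0 st Uu hs; have t0 : 0 < t by exact: le_lt_trans st.
have ts : 0 < t - s by rewrite subr_gt0.
have real_neq0 (a : R) : 0 < a -> a%:C != 0 :> C.
  by move=> a0; rewrite -(rmorph0 (real_complex R)) (inj_eq (@complexI R)) gt_eqF.
exists ((s / t)%:C *: u + ((t - s) / t)%:C *: ((t - s)^-1%:C *: h)).
  apply: absolutely_convexP => //; last first.
    apply: Ub; rewrite nrmZ nrm_real gtr0_norm ?invr_gt0//.
    by rewrite mulrC ltr_pdivrMr// mulrC.
  rewrite !nrm_real !ger0_norm ?divr_ge0 ?(ltW t0) ?(ltW ts)//.
  by rewrite -mulrDl addrC subrK divff// gt_eqF.
rewrite scalerDr !scalerA -!rmorphM; congr (_%:C *: _ + _).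
  by field; rewrite gt_eqF.
rewrite (_ : _ * _ = 1); first by rewrite scale1r.
by field; rewrite !gt_eqF.
Qed.

Lemma absolutely_convex_family U : open U -> absolutely_convex U -> U 0 ->
  exists W : (set (dual X))^nat, [/\ fundamental_family U W,
    forall n, absolutely_convex (W n) & forall n, W n 0].
Proof.
move=> Uo Uac U0.
have [rho rho0 Ub] : exists2 rho : R, 0 < rho & forall v, nrm v < rho -> U v.
  have /nbhs_nrmP[r r0 rP] : nbhs (0 : dual X) U by exact: open_nbhs_nbhs.
  by exists r => // v vr; apply: rP; rewrite subr0.
(* [W n] is a dilate of [U] cut by a ball. The factors increase strictly, which spaces the sets, and
   tend to 1, which lets them absorb. *)
pose s n : R := n.+1%:R / n.+2%:R.
have s0 n : 0 < s n by rewrite divr_gt0.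
have sV n : (s n)^-1 = 1 + n.+1%:R^-1.
  by rewrite invf_div -[n.+2]addn1 natrD mulrDl divff// mul1r.
have s1 n : s n <= 1 by rewrite ler_pdivrMr// mul1r ler_nat.
have sS n : s n < s n.+1.
  rewrite -ltf_pV2 ?posrE// !sV ltrD2l ltf_pV2 ?posrE// ltr_nat//.
pose W n : set (dual X) :=
  [set w | nrm w <= n.+1%:R /\ exists2 u, U u & w = (s n)%:C *: u].
have WU n : W n `<=` U.
  move=> w [_ [u Uu ->]]; apply: absolutely_convexZ => //.
  by rewrite nrm_real gtr0_norm.
have Wfat n : nrm_fattened (W n) (W n.+1).
  exists (Num.min 1 ((s n.+1 - s n) * rho)).
    by rewrite lt_min ltr01 mulr_gt0// subr_gt0.
  move=> w h [wn [u Uu wu]]; rewrite lt_min => /andP[h1 hs]; split.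
    by rewrite -[n.+2]addn1 natrD nrmD_le// ltW.
  have [v Uv uv] := absolutely_convex_dilate Uac Ub (ltW (s0 n)) (sS n) Uu hs.
  by exists v => //; rewrite wu.
exists W; split.
- split.
  + move=> n; apply/U_boundedP; exists n.+1%:R => //.
    have [r r0 rP] := Wfat n; exists r => // w Ww; split; first by case: Ww.
    by move=> h hr; apply/WU/rP.
  + move=> A /U_boundedP[M M0 [r r0 Ar]].
    (* For [w] in [A] the vector [d w] is shorter than [r], so [(1 + d) w] stays in [U]. It remains
       to have [(s n)^-1 = 1 + n.+1%:R^-1] at most [1 + d] and [n.+1] at least [M], hence the index
       [Num.truncn (M + d^-1)]. *)
    pose d := r / (M + 1).
    have M1 : 0 < M + 1 by rewrite addr_gt0.
    have d0 : 0 < d by rewrite divr_gt0.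
    exists (Num.truncn (M + d^-1)); set n := Num.truncn _.
    have nM : M + d^-1 < n.+1%:R by exact: truncnS_gt.
    have dV0 : 0 < d^-1 by rewrite invr_gt0.
    move=> w /Ar[wM wU]; split; first by rewrite (le_trans wM)//; lra.
    have Uw : U ((1 + d)%:C *: w).
      rewrite rmorphD rmorph1 scalerDl scale1r; apply: wU.
      rewrite nrmZ nrm_real gtr0_norm// /d mulrAC ltr_pdivrMr//.
      by rewrite ltr_pM2l// (le_lt_trans wM)// ltrDl.
    exists ((s n)^-1%:C *: w); last first.
      rewrite scalerA -rmorphM divff ?rmorph1 ?scale1r//.
      by rewrite gt_eqF.
    have d1 : 0 < 1 + d by rewrite addr_gt0.
    have -> : (s n)^-1%:C *: w = ((s n)^-1 / (1 + d))%:C *: ((1 + d)%:C *: w).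
      by rewrite scalerA -rmorphM divfK// gt_eqF.
    apply: absolutely_convexZ => //; rewrite nrm_real ger0_norm.
      rewrite ler_pdivrMr// mul1r sV lerD2l -[d]invrK lef_pV2 ?posrE//; lra.
    by rewrite divr_ge0 ?ltW// invr_gt0.
  + by move=> n; apply/nrm_fattenedP.
- move=> n a b w y ab [wn [u Uu wu]] [yn [v Uv yv]]; split; last first.
    exists (a *: u + b *: v); first exact: Uac.
    by rewrite wu yv scalerDr !scalerA ![_ * (s n)%:C]mulrC.
  rewrite -lecR -nrmE (le_trans (ler_normD _ _))// !normrZ.
  rewrite (@le_trans _ _ ((`|a| + `|b|) * (n.+1%:R)%:C))//.
    by rewrite mulrDl lerD// ler_wpM2l// nrmE lecR.
  by rewrite ler_piMl// ler0c.
- move=> n; split; first by rewrite nrm0.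
  by exists 0 => //; rewrite scaler0.
Qed.

Lemma sqr_nrm (z : C) : nrm z ^+ 2 = complex.Re z ^+ 2 + complex.Im z ^+ 2.
Proof.
by rewrite /nrm normc_def/= sqr_sqrtr// addr_ge0// sqr_ge0.
Qed.

Lemma sqr_nrmD (a b : C) (t : R) : nrm (a - t%:C * b) ^+ 2 =
  nrm a ^+ 2 - 2 * t * complex.Re (a^* * b) + t ^+ 2 * nrm b ^+ 2.
Proof. by case: a => a1 a2; case: b => b1 b2; rewrite !sqr_nrm /=; ring. Qed.

(* The functional is [v |-> <y - p, v>] on finitely many coordinates, where [p]
   almost minimises the Euclidean distance from [y] to [W] in these coordinates;
   as [W] is bounded, an approximate minimiser suffices. *)
Lemma weak_star_separation W (M : R) y : absolutely_convex W -> W 0 ->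
  (forall w, W w -> nrm w <= M) -> ~ weak_star_closure W y ->
  exists x : X, (forall w, W w -> nrm (w x) <= 1) /\ 1 < nrm (y x).
Proof.
move=> Wac W0 WM ncl.
have [xs [e e0 far]] : exists xs : seq X, exists2 e : R, 0 < e &
    forall w, W w -> exists2 x, x \in xs & e <= nrm (y x - w x).
  apply: contrapT => no; apply: ncl; apply/weak_star_closureP => xs e e0.
  apply: contrapT => nw; apply: no; exists xs, e => // w Ww.
  apply: contrapT => nx; apply: nw; exists w => // x xin.
  by rewrite ltNge; apply/negP => h; apply: nx; exists x; rewrite // nrmB.
pose q w := \sum_(x <- xs) nrm (y x - w x) ^+ 2.
have qge w : W w -> e ^+ 2 <= q w.
  move=> /far[x xin ex]; rewrite /q (big_rem x)//=.
  apply: ler_wpDr; first by apply: sumr_ge0 => z _; rewrite sqr_ge0.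
  by rewrite lerXn2r// nnegrE ?nrm_ge0// ltW.
have has_q : has_inf (q @` W).
  by split; [exists (q 0), 0|exists (e ^+ 2) => _ [w Ww <-]; exact: qge].
pose d := inf (q @` W).
have d0 : 0 < d.
  rewrite (@lt_le_trans _ _ (e ^+ 2)) ?exprn_gt0//; apply: lb_le_inf; first by case: has_q.
  by move=> _ [w Ww <-]; exact: qge.
have qd w : W w -> d <= q w.
  by move=> Ww; apply: ge_inf; [case: has_q|exists w].
pose D := \sum_(x <- xs) (2 * M * nrm x) ^+ 2.
have D0 : 0 <= D by apply: sumr_ge0 => x _; rewrite sqr_ge0.
(* Moving from [p] towards [w] by [t] changes [q] by a linear term and a quadratic one of size at
   most [t ^+ 2 * D <= t * (d / 2)]. Taking [q p] within [t * (d / 2)] of the infimum then bounds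
   the linear term by [t * d]. *)
pose t := Num.min 1 (d / (2 * (D + 1))).
have t0 : 0 < t by rewrite lt_min ltr01 divr_gt0// mulr_gt0// ltr_wpDl.
have t1 : t <= 1 by rewrite ge_min lexx.
have tD : t * D <= d / 2.
  have : t <= d / (2 * (D + 1)) by rewrite ge_min lexx orbT.
  rewrite ler_pdivlMr ?mulr_gt0 ?ltr_wpDl//; nra.
have [_ [p Wp <-] pd] := inf_adherent (mulr_gt0 t0 (divr_gt0 d0 (ltr0Sn _ 1))) has_q.
rewrite -/d in pd.
pose x0 := \sum_(x <- xs) (y x - p x)^* *: x.
have evx0 (v : dual X) : v x0 = \sum_(x <- xs) (y x - p x)^* * v x.
  by rewrite linear_sum; apply: eq_bigr => x _; rewrite linearZ.
have yx0 : complex.Re (y x0) = complex.Re (p x0) + q p.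
  apply/eqP; rewrite addrC -subr_eq -raddfB !evx0 -sumrB raddf_sum; apply/eqP.
  apply: eq_bigr => x _; rewrite -mulrBr sqr_nrm.
  by case: (y x - p x) => a b /=; ring.
pose beta := complex.Re (p x0) + d / 2.
have Re_le w : W w -> complex.Re (w x0) <= beta.
  move=> Ww.
  have Wt : W ((1 - t)%:C *: p + t%:C *: w).
    apply: absolutely_convexP => //; rewrite !nrm_real !ger0_norm ?subr_ge0 ?(ltW t0)//; lra.
  have qE : q ((1 - t)%:C *: p + t%:C *: w) = q p -
      2 * t * (complex.Re (w x0) - complex.Re (p x0)) +
      t ^+ 2 * \sum_(x <- xs) nrm (w x - p x) ^+ 2.
    rewrite -raddfB !evx0 -sumrB raddf_sum !mulr_sumr /q -sumrB -big_split.
    apply: eq_bigr => x _; rewrite -mulrBr; apply: etrans (sqr_nrmD (y x - p x) (w x - p x) t).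
    congr (nrm _ ^+ 2).
    rewrite dualD !dualZ rmorphB rmorph1 -![_ *: _]/(_ * _); ring.
  have qS : \sum_(x <- xs) nrm (w x - p x) ^+ 2 <= D.
    apply: ler_sum => x _; rewrite lerXn2r ?nnegrE ?nrm_ge0//.
      by rewrite mulr_ge0 ?nrm_ge0// mulr_ge0// (le_trans _ (WM _ W0))// nrm_ge0.
    rewrite -mulrA mulr_natl mulr2n; apply: nrmD_le; rewrite ?nrmN;
      by rewrite (le_trans (nrm_dual_le _ _))// ler_wpM2r ?nrm_ge0// WM.
  have := qd _ Wt; rewrite qE => h.
  have t2 : t ^+ 2 * \sum_(x <- xs) nrm (w x - p x) ^+ 2 <= t * (d / 2).
    rewrite (@le_trans _ _ (t ^+ 2 * D))// ?ler_wpM2l ?sqr_ge0//.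
    by rewrite expr2 -mulrA ler_pM2l.
  have : t * (complex.Re (w x0) - complex.Re (p x0)) <= t * (d / 2) by lra.
  by rewrite ler_pM2l// /beta => ?; lra.
have beta0 : 0 <= beta by have := Re_le 0 W0.
(* As [W] is balanced, [w] can be rotated until its value at [x0] is real and nonnegative. *)
have le_beta w : W w -> nrm (w x0) <= beta.
  move=> Ww; have [->|wn0] := eqVneq (w x0) 0; first by rewrite nrm0.
  have n0 : 0 < nrm (w x0).
    by rewrite lt_def nrm_ge0 andbT; apply: contra_neq wn0 => /nrm0_eq0.
  pose c : C := (w x0)^* * (nrm (w x0))^-1%:C.
  have cw : c * w x0 = (nrm (w x0))%:C.
    rewrite /c mulrAC [(w x0)^* * _]mulrC -sqr_normc nrmE -rmorphXn -rmorphM.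
    by congr (_%:C); field; rewrite gt_eqF.
  have c1 : nrm c <= 1.
    have : nrm c * nrm (w x0) = nrm (w x0).
      by rewrite -nrmM cw nrm_real gtr0_norm.
    by move=> /(canRL (mulfK _)) ->; rewrite ?divff// gt_eqF.
  by have := Re_le _ (absolutely_convexZ Wac c1 Ww); rewrite dualZ -[_ *: _]/(c * _) cw.
(* [g] separates strictly: the real part of [y x0] is at least [beta + d / 2] because [q p >= d]. *)
pose g := beta + d / 4; have g0 : 0 < g by rewrite /g; lra.
have ng (v : dual X) : nrm (v ((g^-1)%:C *: x0)) = nrm (v x0) / g.
  by rewrite linearZ/= nrmZ nrm_real gtr0_norm ?invr_gt0// mulrC.
exists ((g^-1)%:C *: x0); split.
  by move=> w /le_beta wb; rewrite ng ler_pdivrMr// /g; lra.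
rewrite ng ltr_pdivlMr// mul1r (lt_le_trans _ (le_Re_nrm _))//.
rewrite (lt_le_trans _ (ler_norm _))// yx0.
by have := qd _ Wp; rewrite /g /beta; lra.
Qed.

End absolutely_convex_sets.

(** * Lacunary series *)

Section weak_star_functions.
Variables (R : realType) (X : normedModType R[i]).
Local Notation C := R[i].
Implicit Types (A B : set (dual X)) (f g : dual X -> C^o) (y : dual X).

Definition bounded_function_on (T : Type) (D : set T) (h : T -> C) :=
  exists K : R, forall w, D w -> nrm (h w) <= K.

Lemma bounded_function_slabs (T : Type) (A : set T) (g : T -> C) (phi : T -> R) (d B : R) :
  0 < d -> (forall w, A w -> `|phi w| <= B) ->
  (forall t, bounded_function_on (A `&` [set w | t <= phi w < t + d]) g) ->
  bounded_function_on A g.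
Proof.
move=> d0 phiB slab.
have slabs n : bounded_function_on (A `&` [set w | - B <= phi w < - B + n%:R * d]) g.
  elim: n => [|n [K KP]].
    exists 0 => w [_ /= /andP[/le_lt_trans h /h]].
    by rewrite mul0r addr0 ltxx.
  have [L LP] := slab (- B + n%:R * d).
  exists (Num.max K L) => w [Aw /= /andP[w1 w2]]; rewrite le_max.
  have [wn|wn] := ltP (phi w) (- B + n%:R * d); first by rewrite KP//= w1 wn.
  rewrite [X in _ || X]LP ?orbT//; split=> //=; rewrite wn/=.
  by move: w2; rewrite -natr1 mulrDl mul1r addrA.
have [K KP] := slabs (Num.truncn (2 * B / d)).+1.
exists K => w Aw; apply: KP; split=> //=.
have := phiB _ Aw; rewrite ler_norml => /andP[-> /= h].
have : 2 * B / d < (Num.truncn (2 * B / d)).+1%:R by exact: truncnS_gt.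
by rewrite ltr_pdivrMr// => h2; lra.
Qed.

(** Norm bounded sets are totally bounded for finitely many coordinates. Cutting the real and
    imaginary parts of one coordinate into strips of width [e / 2] makes that coordinate vary by
    less than [e], so the induction can drop it from the list. *)
Lemma bounded_of_uniform_oscillation (xs : seq X) (e : R) (g : dual X -> C) A :
  0 < e -> (exists M : R, forall w, A w -> nrm w <= M) ->
  (forall w y, A w -> A y -> weak_star_box xs e y w -> nrm (g w - g y) <= 1) ->
  bounded_function_on A g.
Proof.
move=> e0; elim: xs A => [|x xs IH] A [M AM] osc.
  have [[y Ay]|A0] := pselect (exists y, A y); last first.
    by exists 0 => w Aw; case: A0; exists w.
  exists (1 + nrm (g y)) => w Aw; rewrite -(subrK (g y) (g w)).
  by apply: nrmD_le => //; apply: osc.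
have wx w : A w -> nrm (w x) <= M * nrm x.
  move=> Aw; rewrite (le_trans (nrm_dual_le _ _))//.
  by rewrite ler_wpM2r ?nrm_ge0// AM.
have e2 : 0 < e / 2 by rewrite divr_gt0.
apply: (@bounded_function_slabs (dual X) _ g
  (fun w : dual X => complex.Re (w x)) (e / 2) (M * nrm x)) => //.
  by move=> w /wx; apply: le_trans; exact: le_Re_nrm.
move=> s; apply: (@bounded_function_slabs (dual X) _ g
  (fun w : dual X => complex.Im (w x)) (e / 2) (M * nrm x)) => //.
  by move=> w [/wx + _]; apply: le_trans; exact: le_Im_nrm.
move=> t; apply: IH; first by exists M => w [[/AM]].
move=> w y [[Aw /= /andP[w1 w2]] /= /andP[w3 w4]] [[Ay /= /andP[y1 y2]] /= /andP[y3 y4]] wy.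
apply: osc => // z; rewrite inE => /orP[/eqP->|/wy//].
rewrite (le_lt_trans (nrm_leReIm _))// !raddfB [e]splitr ltrD// ltr_norml; lra.
Qed.

Lemma bounded_weak_star_unif_continuous B f : bounded_set B ->
  weak_star_unif_continuous_on B f -> bounded_function_on B f.
Proof.
move=> /bounded_setP[M _ BM] /weak_star_unif_continuousP/(_ 1 ltr01)[xs [d d0 dP]].
by apply: (bounded_of_uniform_oscillation d0 _ dP); exists M.
Qed.

Lemma nrm_subX (M : R) k : exists2 L : R, 0 <= L & forall a b : C,
  nrm a <= M -> nrm b <= M -> nrm (a ^+ k - b ^+ k) <= L * nrm (a - b).
Proof.
have [M0|M0] := ltP M 0.
  by exists 0 => // a b /le_lt_trans/(_ M0); rewrite ltNge nrm_ge0.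
elim: k => [|k [L L0 LP]].
  by exists 0 => // a b _ _; rewrite !expr0 subrr nrm0 mul0r.
exists (M * L + M ^+ k); first by rewrite addr_ge0 ?mulr_ge0 ?exprn_ge0.
move=> a b aM bM.
have -> : a ^+ k.+1 - b ^+ k.+1 = a * (a ^+ k - b ^+ k) + b ^+ k * (a - b).
  by rewrite !exprS; ring.
rewrite mulrDl -mulrA; apply: nrmD_le; rewrite nrmM.
  by rewrite ler_pM ?nrm_ge0// LP.
by rewrite ler_wpM2r ?nrm_ge0// nrmX lerXn2r ?nnegrE ?nrm_ge0.
Qed.

Lemma weak_star_unif_continuousX B x k : bounded_set B ->
  weak_star_unif_continuous_on B (fun w => (w x : C) ^+ k : C^o).
Proof.
move=> /bounded_setP[M _ BM]; apply/weak_star_unif_continuousP => e e0.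
have [L L0 LP] := nrm_subX (M * nrm x) k.
have L1 : 0 < L + 1 by rewrite ltr_wpDl.
exists [:: x], (e / (L + 1)); first by rewrite divr_gt0.
have bx w : B w -> nrm (w x) <= M * nrm x.
  move=> Bw; rewrite (le_trans (nrm_dual_le _ _))//.
  by rewrite ler_wpM2r ?nrm_ge0// BM.
move=> w y /bx wM /bx yM /(_ x (mem_head _ _)); rewrite ltr_pdivlMr// => wy.
rewrite (le_trans (LP _ _ wM yM))// (le_trans _ (ltW wy))//.
by rewrite mulrC ler_wpM2l ?nrm_ge0// lerDl.
Qed.

Lemma weak_star_unif_continuousD B f g :
  weak_star_unif_continuous_on B f -> weak_star_unif_continuous_on B g ->
  weak_star_unif_continuous_on B (fun w => f w + g w).
Proof.
move=> /weak_star_unif_continuousP hf /weak_star_unif_continuousP hg.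
apply/weak_star_unif_continuousP => e e0; have e2 : 0 < e / 2 by rewrite divr_gt0.
have [xs [d d0 dP]] := hf _ e2; have [ys [c c0 cP]] := hg _ e2.
exists (xs ++ ys), (Num.min d c); first by rewrite lt_min d0.
move=> w y Bw By wy; rewrite opprD addrACA [e]splitr; apply: nrmD_le.
  apply: dP => //; apply: weak_star_box_weaken wy; last by rewrite ge_min lexx.
  by move=> x; rewrite mem_cat => ->.
apply: cP => //; apply: weak_star_box_weaken wy; last by rewrite ge_min lexx orbT.
by move=> x; rewrite mem_cat => ->; rewrite orbT.
Qed.

Lemma weak_star_unif_continuous_limit B f :
  (forall e : R, 0 < e -> exists2 g, weak_star_unif_continuous_on B g &
     forall w, B w -> nrm (g w - f w) <= e) ->
  weak_star_unif_continuous_on B f.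
Proof.
move=> approx; apply/weak_star_unif_continuousP => e e0.
have e3 : 0 < e / 3 by rewrite divr_gt0.
have [g /weak_star_unif_continuousP/(_ _ e3)[xs [d d0 dP]] gf] := approx _ e3.
exists xs, d => // w y Bw By wy.
have -> : e = e / 3 + (e / 3 + e / 3) by field.
apply: (@nrmB_le _ _ _ (g w)); first by rewrite nrmB; apply: gf.
by apply: (@nrmB_le _ _ _ (g y)); [exact: dP|exact: gf].
Qed.

Lemma differentiable_evalX x k y :
  differentiable (fun w : dual X => (w x : C) ^+ k : C^o) y.
Proof.
have lin : linear (fun w : dual X => w x : C^o) by [].
pose L : {linear dual X -> C^o} := HB.pack (fun w : dual X => w x : C^o)
  (GRing.isLinear.Build _ _ _ _ _ lin).
have cL : continuous L.
  apply/linear_bounded_continuous/linear_boundedP.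
  near=> r => w; rewrite (@le_trans _ _ ((nrm x)%:C * `|w|))//.
    by rewrite !nrmE -rmorphM lecR mulrC; exact: nrm_dual_le.
  rewrite ler_wpM2r//; near: r; apply: nbhs_pinfty_ge.
  by rewrite realE ler0c nrm_ge0.
have dL : differentiable (fun w : dual X => w x : C^o) y.
  by have := linear_differentiable (f := L) y cL.
case: k => [|k]; first exact: differentiable_cst.
have -> : (fun w : dual X => (w x : C) ^+ k.+1 : C^o) =
    ((fun w : dual X => w x : C) : dual X -> C) ^+ k.+1.
  by apply/funext => w; rewrite exprfctE.
exact: (@differentiableX C (dual X) (fun w : dual X => w x : C)).
Unshelve. all: by end_near. Qed.

Lemma differentiable_add f g y : differentiable f y -> differentiable g y ->
  differentiable (fun w => f w + g w) y.
Proof. by move=> df dg; exact: (differentiableD df dg). Qed.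

End weak_star_functions.

Section real_sequences.
Variable R : realType.

(** The limit is quantified before the threshold [n0], so that one value of the series serves all
    thresholds; it is 0 when there is none. *)
Lemma dyadic_cauchy (u : nat -> R[i]) : exists l : R[i], forall n0,
  (forall n, (n0 <= n)%N -> nrm (u n.+1 - u n) <= 2 ^- n.+1) ->
  forall n, (n0 <= n)%N -> nrm (l - u n) <= 2 ^- n.
Proof.
have [[n0 un0]|no] := pselect (exists n0, forall n, (n0 <= n)%N ->
    nrm (u n.+1 - u n) <= 2 ^- n.+1); last first.
  by exists 0 => n0 h; case: no; exists n0.
have half k : 2 ^- k = 2 ^- k.+1 + 2 ^- k.+1 :> R.
  by rewrite [LHS]splitr exprSr invfM.
have tail n1 : (forall n, (n1 <= n)%N -> nrm (u n.+1 - u n) <= 2 ^- n.+1) ->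
    forall n m, (n1 <= n)%N -> (n <= m)%N -> nrm (u m - u n) <= 2 ^- n - 2 ^- m.
  move=> un1 n m n1n nm; rewrite -(subnK nm); elim: (m - n)%N => [|k IH].
    by rewrite add0n !subrr nrm0.
  rewrite addSn; have -> : 2 ^- n - 2 ^- (k + n).+1 = 2 ^- (k + n).+1 + (2 ^- n - 2 ^- (k + n)) :> R.
    by rewrite (half (k + n)%N); ring.
  by apply: (@nrmB_le _ _ _ (u (k + n)%N)) => //; apply: un1; rewrite (leq_trans n1n)// leq_addl.
have p0 n : 0 < 2 ^- n :> R by rewrite invr_gt0 exprn_gt0.
have [|l lP] := @complex_cauchy R u.
  move=> e e0; have [k ke] := exp2V_lt 1 e0; rewrite mulr1 in ke.
  exists (maxn n0 k) => n kn.
  rewrite (le_trans (tail n0 un0 _ _ _ kn)) ?leq_maxl//.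
  rewrite (@le_trans _ _ (2 ^- k))//; last exact: ltW.
  have : 2 ^- maxn n0 k <= 2 ^- k :> R.
    by rewrite lef_pV2 ?posrE ?exprn_gt0// ler_eXn2l ?leq_maxr// ltr1n.
  by have := p0 n; lra.
exists l => n1 un1 n n1n; apply/ler_addgt0Pr => e e0.
have [N NP] := lP _ e0.
rewrite [_ + e]addrC; apply: (@nrmB_le _ _ _ (u (maxn n N))).
  by rewrite nrmB NP// leq_maxr.
rewrite (le_trans (tail n1 un1 _ _ n1n (leq_maxl _ _)))//.
by have := p0 (maxn n N); lra.
Qed.

Lemma exp_small (t e : R) : 0 <= t < 1 -> 0 < e ->
  exists n0, forall n, (n0 <= n)%N -> t ^+ n <= e.
Proof.
move=> /andP[t0 t1] e0; have : t ^+ n @[n --> \oo] --> 0 by apply: cvg_expr; rewrite ger0_norm.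
move=> /cvgrPdist_le/(_ _ e0)[N _ NP]; exists N => n /NP/=.
by rewrite sub0r normrN ger0_norm// exprn_ge0.
Qed.

Lemma exp_small_fin (t : nat -> R) (e : R) K : (forall k, 0 <= t k < 1) -> 0 < e ->
  exists n0, forall n, (n0 <= n)%N -> forall k, (k < K)%N -> t k ^+ n <= e.
Proof.
move=> t01 e0; elim: K => [|K [n0 IH]]; first by exists 0%N.
have [n1 H] := exp_small (t01 K) e0.
exists (maxn n0 n1) => n; rewrite geq_max => /andP[n0n n1n] k.
by rewrite ltnS leq_eqVlt => /orP[/eqP->|]; [exact: H|exact: IH].
Qed.

Lemma exp_large (c B : R) : 1 < c -> exists n0, forall n, (n0 <= n)%N -> B <= c ^+ n.
Proof.
move=> c1; have c0 : 0 < c by rewrite (lt_trans _ c1).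
have [||n0 H] := @exp_small c^-1 (`|B| + 1)^-1.
- by rewrite invr_ge0 (ltW c0) invf_lt1.
- by rewrite invr_gt0 ltr_wpDl//.
exists n0 => n /H; rewrite exprVn lef_pV2 ?posrE ?exprn_gt0 ?ltr_wpDl//.
by apply: le_trans; rewrite (le_trans (ler_norm _))// lerDl.
Qed.

End real_sequences.

(** * Absorption of the bounded sets of the envelope by a gliding hump *)

Section gliding_hump.
Variables (R : realType) (X : normedModType R[i]).
Local Notation C := R[i].
Implicit Types (U A : set (dual X)) (W : (set (dual X))^nat) (w y : dual X).

Lemma sub_envelope U A : U_bounded U A -> weak_star_closure A `<=` envelope U.
Proof. by move=> UA y Ay; exists A. Qed.

Lemma U_bounded_weak_star_closure U W n : fundamental_family U W ->
  U_bounded (envelope U) (weak_star_closure (W n)).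
Proof.
move=> famW; have [WU _ _] := famW.
have /U_boundedP[M M0 [? _ WM]] := WU n.
have [r r0 rP] := nrm_fattened_closure (fundamental_familyS n famW).
apply/U_boundedP; exists M => //; exists r => // w Ww; split.
  by apply: weak_star_closure_ball Ww => v /WM[].
by move=> h hr; apply: (sub_envelope (WU n.+1)); exact: rP.
Qed.

(** A fixed dilation by [1 + d] maps [W m] into [W m.+1], hence into every later [W n]; so
    [t = (1 + d)^-1] depends on [m] only, and large powers make the terms of the series small on
    [W m]. *)
Lemma fundamental_family_shrink U W m : fundamental_family U W ->
  exists t : R, 0 <= t < 1 /\ forall n w (z : X), (m < n)%N -> W m w ->
    (forall v, W n v -> nrm (v z) <= 1) -> nrm (w z) <= t.
Proof.
move=> famW; have [WU _ _] := famW.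
have /U_boundedP[M M0 [? _ WM]] := WU m.
have [r r0 rP] := fundamental_familyS m famW.
have M1 : 0 < M + 1 by rewrite addr_gt0.
pose d := r / (M + 1); have d0 : 0 < d by rewrite divr_gt0.
have d1 : 0 < 1 + d by rewrite addr_gt0.
exists (1 + d)^-1; split.
  by rewrite invr_ge0 (ltW d1) invf_lt1// ltrDl.
move=> n w z mn Ww nz; rewrite -[_^-1]mul1r ler_pdivlMr//.
have : nrm ((w + d%:C *: w) z) <= 1.
  apply/nz/(fundamental_family_mono mn famW)/rP => //.
  rewrite nrmZ nrm_real gtr0_norm// /d mulrAC ltr_pdivrMr// ltr_pM2l//.
  by have [wM _] := WM _ Ww; rewrite (le_lt_trans wM)// ltrDl.
have -> : (w + d%:C *: w) z = (1 + d)%:C * (w z : C).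
  by rewrite dualD dualZ rmorphD rmorph1 mulrDl mul1r.
by rewrite nrmM nrm_real gtr0_norm// mulrC.
Qed.

(** The partial sums converge uniformly on each [W m], which gives membership in [Hwsu U]. The tail
    bound keeps a threshold that depends on the point, because the gliding hump evaluates the tail
    right after its large term. *)
Lemma lacunary_series U W (x : nat -> X) (k : nat -> nat) :
  open U -> fundamental_family U W ->
  (forall m, exists n0, forall w n, W m w -> (n0 <= n)%N ->
     nrm (w (x n)) ^+ k n <= 2 ^- n.+1) ->
  exists2 f : dual X -> R[i]^o, Hwsu U f & forall w n0,
    (forall n, (n0 <= n)%N -> nrm (w (x n)) ^+ k n <= 2 ^- n.+1) ->
    forall n, (n0 <= n)%N ->
      nrm (f w - \sum_(i < n) (w (x i) : C) ^+ k i : C) <= 2 ^- n.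
Proof.
move=> Uo famW small; have [WU Wabs _] := famW.
pose p n w : C := \sum_(i < n) (w (x i) : C) ^+ k i.
have pS n : p n.+1 = fun w => p n w + (w (x n) : C) ^+ k n.
  by apply/funext => w; rewrite /p big_ord_recr.
have p0 : p 0%N = fun=> 0 by apply/funext => w; rewrite /p big_ord0.
have /choice[f fP] : forall w, exists l : C^o, forall n0,
    (forall n, (n0 <= n)%N -> nrm (w (x n)) ^+ k n <= 2 ^- n.+1) ->
    forall n, (n0 <= n)%N -> nrm (l - p n w : C) <= 2 ^- n.
  move=> w; have [l lP] := dyadic_cauchy (fun n => p n w); exists l => n0 h.
  by apply: lP => n /h; rewrite pS addrAC subrr add0r nrmX.
have exp0 (e : R) : 0 < e -> forall n0, exists2 n, (n0 <= n)%N & 2 ^- n <= e.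
  move=> e0 n0; have [n ne] := exp2V_lt 1 e0; rewrite mulr1 in ne.
  exists (maxn n0 n); rewrite ?leq_maxl// (le_trans _ (ltW ne))//.
  by rewrite lef_pV2 ?posrE ?exprn_gt0// ler_eXn2l ?leq_maxr// ltr1n.
have approx m (e : R) : 0 < e -> exists n, forall w, W m w -> nrm (f w - p n w : C) <= e.
  move=> e0; have [n0 n0P] := small m; have [n n0n ne] := exp0 e e0 n0.
  exists n => w Ww; rewrite (le_trans _ ne)//; apply: fP n0n => j n0j.
  exact: n0P.
exists f => //; split; last first.
  move=> A /Wabs[m Am]; apply: weak_star_unif_continuous_limit => e /(approx m)[n nP].
  exists (p n); last by move=> w /Am /nP; rewrite nrmB.
  have bW : bounded_set (W m) by case: (WU m).
  have bA : bounded_set A.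
    have /bounded_setP[M M0 WM] := bW.
    by apply/bounded_setP; exists M => // w /Am /WM.
  elim: {nP} n => [|n IH].
    rewrite p0; apply/weak_star_unif_continuousP => d d0.
    by exists [::], 1 => // *; rewrite subrr nrm0 ltW.
  by rewrite pS; apply: weak_star_unif_continuousD => //; exact: weak_star_unif_continuousX.
move=> w Uw; have [m /(_ w erefl) Ww] := Wabs _ (U_bounded1 Uo Uw).
have [r r0 rP] := fundamental_familyS m famW.
apply: (uniform_limit_differentiable r0) => e /(approx m.+1)[n nP].
exists (p n) => h hr; split; last exact/nP/rP.
elim: {nP} n => [|n IH]; first by rewrite p0; exact: differentiable_cst.
rewrite pS; apply: differentiable_add => //; exact: differentiable_evalX.
Qed.

(* Gliding hump: were [A] not absorbed, separation would give points [y_j] of [A]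
   and [z_j] in [X] with [`|y_j z_j| > 1] and [`|w z_j| <= 1] on [W (N j)]; for
   fast growing exponents the series of the [(w z_j) ^+ k j] belongs to
   [Hwsu U], but an extension of it is unbounded along the [y_j]. *)
Lemma extension_absorbs U W A : open U -> fundamental_family U W ->
  (forall n, absolutely_convex (W n)) -> (forall n, W n 0) ->
  (forall f, Hwsu U f ->
     exists2 g, Hwsu (envelope U) g & forall w, U w -> g w = f w) ->
  U_bounded (envelope U) A -> exists n, A `<=` weak_star_closure (W n).
Proof.
move=> Uo famW Wac W0 ext EA; apply: contrapT => no.
have [WU Wabs _] := famW.
have /U_boundedP[M M0 [? _ AM]] := EA.
have AE : A `<=` envelope U by case: EA.
have /choice[s sP] : forall n, exists q : dual X * X * nat, [/\ A q.1.1,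
    forall w, W n w -> nrm (w q.1.2) <= 1, 1 < nrm (q.1.1 q.1.2) &
    weak_star_closure (W q.2) q.1.1].
  move=> n; have [y Ay ny] : exists2 y, A y & ~ weak_star_closure (W n) y.
    apply: contrapT => h; apply: no; exists n => y Ay.
    by apply: contrapT => ny; apply: h; exists y.
  have /U_boundedP[L _ [? _ WL]] := WU n.
  have [z [z1 yz]] := weak_star_separation (Wac n) (W0 n) (fun w Ww => (WL w Ww).1) ny.
  have [B /Wabs[m Bm] By] := AE _ Ay.
  by exists (y, z, m); split=> //=; exact: weak_star_closureS By.
have /choice[t tP] := fun m => fundamental_family_shrink m famW.
(* [N] jumps past the index [(s n).2] of a closure containing the current point, so all later
   separating points are bounded by 1 on that set of the family. *)
pose N j := iter j (fun n => (maxn n (s n).2).+1) 0%N.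
have N_gt i j : (i < j)%N -> (N i < N j)%N /\ ((s (N i)).2 < N j)%N.
  move=> ij; rewrite -(subnK ij); elim: (j - i.+1)%N => [|d [IH1 IH2]].
    by rewrite add0n /N /= !ltnS leq_maxl leq_maxr.
  by rewrite addSn /N/= !ltnS -/(N _) !leq_max ltnW// (ltnW IH2).
have N_ge j : (j <= N j)%N.
  by elim: j => // j IH; rewrite (leq_ltn_trans IH)//; case: (N_gt j j.+1 (ltnSn j)).
pose Y j := (s (N j)).1.1; pose Z j := (s (N j)).1.2.
have AY j : A (Y j) by case: (sP (N j)).
have Z1 j w : W (N j) w -> nrm (w (Z j)) <= 1 by case: (sP (N j)) => _ + _ _; apply.
have YZ j : 1 < nrm (Y j (Z j)) by case: (sP (N j)).
(* Being halfway, [c j] remains a lower bound above 1 at points whose value at [Z j] is close to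
   that of [Y j]; [b j] below bounds the value at [Z j] of points within 1 there of a point of
   [A]. *)
pose c j := (1 + nrm (Y j (Z j))) / 2.
have c1 j : 1 < c j by have := YZ j; rewrite /c; lra.
pose b j := M * nrm (Z j) + 1.
(* The exponent depends on the bound [q.2] for the earlier terms, which involves the earlier
   exponents; with this bound as an argument, [S] and [k] can be defined by recursion. The [j]-th
   term exceeds the earlier ones by [j + 2], yet is summably small on all [W m] with [m < N j]. *)
have /choice[kappa kappaP] : forall q : nat * R, exists k,
    q.1%:R + 2 + q.2 <= c q.1 ^+ k /\
    forall m, (m < N q.1)%N -> t m ^+ k <= 2 ^- q.1.+1.
  move=> [j S] /=; have [k1 h1] := exp_large (j%:R + 2 + S) (c1 j).
  have e0 : 0 < 2 ^- j.+1 :> R by rewrite invr_gt0 exprn_gt0.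
  have [k2 h2] := exp_small_fin (N j) (fun m => (tP m).1) e0.
  by exists (maxn k1 k2); split; [apply: h1; rewrite leq_maxl|apply: h2; rewrite leq_maxr].
pose S := fix S j : R := if j is i.+1 then S i + b i ^+ kappa (i, S i) else 0.
pose k j := kappa (j, S j).
have SE j : S j = \sum_(i < j) b i ^+ k i.
  by elim: j => [|j IH]; rewrite ?big_ord0// big_ord_recr/= -IH.
have term m w n : W m w -> (m < N n)%N -> nrm (w (Z n)) ^+ k n <= 2 ^- n.+1.
  move=> Ww mn; have [_ /(_ m mn)] := kappaP (n, S n); apply: le_trans.
  have [/andP[t0 _] /(_ _ _ _ mn Ww (Z1 n)) wt] := tP m.
  by rewrite lerXn2r// nnegrE nrm_ge0.
have [|f fH fP] := @lacunary_series U W Z k Uo famW.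
  by move=> m; exists m.+1 => w n Ww mn; apply: term Ww _; exact: leq_trans (N_ge n).
have [g [_ guc] gf] := ext f fH.
have [K gK] : bounded_function_on A g.
  by apply: bounded_weak_star_unif_continuous; [case: EA|exact: guc].
pose j := (Num.truncn K).+1.
have Kj : K < j%:R by exact: truncnS_gt.
have Ycl : weak_star_closure (W (s (N j)).2) (Y j) by case: (sP (N j)).
have Eb := U_bounded_weak_star_closure (s (N j)).2 famW.
have /weak_star_unif_continuousP/(_ 1 ltr01)[xs [d d0 dP]] := guc _ Eb.
have gap : 0 < nrm (Y j (Z j)) - c j by have := YZ j; rewrite /c; lra.
(* The box controls the coordinates [xs], for which [g] varies by at most 1, and [Z 0] to [Z j], for
   which the first [j.+1] terms keep their bounds. *)
have /weak_star_closureP := Ycl.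
move=> /(_ (xs ++ map Z (iota 0 j.+1)) (Num.min d (Num.min 1 (nrm (Y j (Z j)) - c j)))).
rewrite !lt_min d0 ltr01 gap => /(_ isT)[w Ww wY].
have wZ i : (i <= j)%N -> nrm (w (Z i) - Y j (Z i)) < Num.min 1 (nrm (Y j (Z j)) - c j).
  move=> ij; have := wY (Z i); rewrite mem_cat map_f ?orbT; last by rewrite mem_iota.
  by rewrite lt_min => /(_ isT)/andP[].
have gw : nrm (f w) <= 1 + K.
  rewrite -gf; last by case: (WU (s (N j)).2) => + _ _; apply.
  rewrite -(subrK (g (Y j)) (g w)); apply: nrmD_le; last exact: gK.
  apply: dP => //; first exact: sub_weak_star_closure.
  apply: weak_star_box_weaken wY; last by rewrite ge_min lexx.
  by move=> z; rewrite mem_cat => ->.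
have wb i : (i <= j)%N -> nrm (w (Z i)) <= b i.
  move=> /wZ; rewrite lt_min => /andP[h _].
  rewrite -(subrK (Y j (Z i)) (w (Z i))) /b addrC; apply: nrmD_le; last exact: ltW.
  by rewrite (le_trans (nrm_dual_le _ _))// ler_wpM2r ?nrm_ge0//; case: (AM _ (AY j)).
have wc : c j <= nrm (w (Z j)).
  have := wZ j (leqnn j); rewrite lt_min => /andP[_ h].
  have : nrm (Y j (Z j)) <= nrm (Y j (Z j) - w (Z j)) + nrm (w (Z j)).
    by rewrite -[X in nrm X <= _](subrK (w (Z j))) nrmD.
  by rewrite nrmB; lra.
have := fP w j.+1 (fun n jn => term _ _ _ Ww (N_gt j n jn).2) j.+1 (leqnn _).
rewrite big_ord_recr/=; set P := \sum_(i < j) _; set T := _ ^+ k j => fPT.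
have PS : nrm P <= S j.
  rewrite SE (le_trans (nrm_sum _ (fun i => (w (Z i) : C) ^+ k i)))//.
  apply: ler_sum => i _; rewrite nrmX lerXn2r ?nnegrE ?nrm_ge0//.
    by rewrite addr_ge0// mulr_ge0 ?nrm_ge0// ltW.
  by apply: wb; rewrite ltnW.
have Tge : j%:R + 2 + S j <= nrm T.
  rewrite nrmX; have [h _] := kappaP (j, S j); rewrite (le_trans h)//.
  by rewrite lerXn2r// nnegrE ?nrm_ge0// ltW// (lt_trans _ (c1 j)).
have two1 : 2 ^- j.+1 <= 1 :> R.
  by rewrite invf_le1 ?exprn_gt0// exprn_ege1// ler1n.
(* With [K < j%:R] this is less than [j%:R + 2 + S j], the lower bound in [Tge]. *)
have Tle : nrm T <= 2 ^- j.+1 + (1 + K) + S j.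
  have -> : T = - (f w - (P + T)) + f w - P by ring.
  by apply: nrmD_le; rewrite ?nrmN//; apply: nrmD_le; rewrite ?nrmN.
lra.
Qed.

End gliding_hump.

Theorem theorem5p1 (R : realType) (X : completeNormedModType R[i])
    (U : set (dual X)) (Uac : absolutely_convex U) (Uo : open U) :
  (forall f : dual X -> R[i]^o, Hwsu U f ->
     exists2 g : dual X -> R[i]^o, Hwsu (envelope U) g & forall x, U x -> g x = f x)
  <-> boundedly_regular U.
Proof.
split; last by move=> reg f; exact: boundedly_regular_extension.
move=> ext.
have [W [famW absW]] : exists W : (set (dual X))^nat, fundamental_family U W /\
    forall A, U_bounded (envelope U) A -> exists n, A `<=` weak_star_closure (W n).
  (* [absolutely_convex] admits the empty set; its envelope is empty and the constant family [set0]
     works. *)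
  have [[u Uu]|U0] := pselect (exists u, U u); last first.
    have Ub A : U_bounded U A -> A = set0.
      by move=> [AU _ _]; apply/seteqP; split=> // w /AU Uw; apply: U0; exists w.
    exists (fun=> set0); split; last first.
      by move=> A [AE _ _]; exists 0%N => w /AE[B /Ub-> /weak_star_closureP/(_ [::] 1 ltr01)[]].
    split=> [_|A /Ub->|_]; last 2 first.
    - by exists 0%N.
    - by exists 1 => // _ [w []].
    by apply/U_boundedP; exists 1 => //; exists 1.
  have U0 : U 0 by rewrite -(scale0r u); apply: absolutely_convexZ => //; rewrite nrm0.
  have [W [famW Wac W0]] := absolutely_convex_family Uo Uac U0.
  by exists W; split=> // A; exact: extension_absorbs.
exists W => //; split=> // n.
  exact: U_bounded_weak_star_closure.
apply/nrm_fattenedP; apply: nrm_fattened_closure; exact: fundamental_familyS famW.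
Qed.
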